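(* Let $X(t)_{t\ge 0}$ be a time homogeneous Markov process (in discrete or continuous time) with càdlàg paths and the strong Markov property. Assume $X(t)_{t\ge0}$ has a quasistationary distribution (QSD) $\rho$ in an open set $U$, and that $T=\inf\{t\ge 0: X(t)\notin U\}$ is finite almost surely. Let $(X_m(t)_{t\ge0},T_m)_{m\ge1}$ be copies of $(X(t)_{t\ge0},T)$ such that: (a) conditional on $X_m(0)$, $X_m(t)_{t\ge0}$ is independent of $(X_k(t)_{t\ge0})_{1\le k<m}$; (b) $\mathcal L(X_m(0)\mid T_{m-1}>t_{m-1},\ldots,T_1>t_1)=\rho$ for $m\ge2$, and $\mathcal L(X_1(0))=\rho$, where $t_m>0$ are deterministic times satisfying $\sum_{m=1}^\infty t_m=\infty$. Define $L=\inf\{m\ge1: T_m\le t_m\}$, $T_{par}=t_1+\cdots+t_{L-1}+T_L$ and $X_{par}=X_L(T_L)$. Let $X(t)_{t\ge0}$ be such that $\mathcal L(X(0))=\rho$, and set $T=\inf\{t>0:X(t)\notin U\}$. Then $$(T_{par},X_{par})\stackrel{\mathcal L}{=}(T,X(T)).$$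
   Context: The process takes values in a standard Borel state space (with a topology, so that ''open'' and ''càdlàg'' make sense). Time is either discrete ($t\in\{0,1,2,\dots\}$, in which case the times $t_m$ are integers) or continuous ($t\in[0,\infty)$). $\mathcal L$ denotes probability law, and $\stackrel{\mathcal L}{=}$ equality in law. A random object is called a copy of another random object if it has the same law as that object. A probability measure $\rho$ is a QSD of $X(t)_{t\ge0}$ in $U$ if $\rho(U)=1$ and, with $T=\inf\{t\ge0:X(t)\notin U\}$, $\rho(A)=\mathbb P(X(t)\in A\mid \mathcal L(X(0))=\rho,\ T>t)$ for every $t\ge0$ and measurable $A\subseteq U$. Standing assumption: the QSD of $X(t)_{t\ge0}$ in $U$ exists, is unique, and for any initial distribution of $X(0)$ supported in $U$ one has $\rho(A)=\lim_{t\to\infty}\mathbb P(X(t)\in A\mid X(s)\in U\text{ for } s\in[0,t])$ for all measurable $A\subseteq U$. *)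

(* Defs.v *)
From HB Require Import structures.
From mathcomp Require Import all_boot all_order all_algebra.
From mathcomp Require Import all_classical all_reals all_analysis.
From mathcomp Require Import measurable_realfun.

Set Implicit Arguments.
Unset Strict Implicit.
Unset Printing Implicit Defensive.

Import Order.TTheory GRing.Theory Num.Theory.
Import numFieldNormedType.Exports.

Local Open Scope classical_set_scope.
Local Open Scope ring_scope.

(* The Borel sigma-algebra of a topological space, carried by an alias of it. *)
Notation borel E := (g_sigma_algebraType (@open E)).

(* Borel isomorphic to a Borel subset of the real line. *)
Definition standard_borel (R : realType) d (T : measurableType d) : Prop :=
  exists f : T -> R,
    [/\ measurable_fun setT f, injective f &
        forall A : set T, measurable A -> measurable (f @` A)].

Inductive time_kind := Discrete | Continuous.

(* Processes are indexed by all of [R], but only their values at the times in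
   [times k] are ever used. *)
Definition times (R : realType) (k : time_kind) : set R :=
  match k with
  | Discrete => [set t | exists n : nat, t = n%:R]
  | Continuous => [set t | 0 <= t]
  end.
Arguments times {R} k.

(* Vacuous when [k = Discrete], the filters being then improper. *)
Definition cadlag (R : realType) (k : time_kind) (E : topologicalType)
    (x : R -> E) : Prop :=
  forall t : R, times k t ->
    (x s @[s --> within (times k) (at_right t)] --> x t) /\
    (0 < t ->
      exists l : E, x s @[s --> within (times k) (at_left t)] --> l).

Definition sigma_of d (Omega : measurableType d) d' (E : measurableType d')
    (J : Type) (D : set J) (Y : J -> Omega -> E) : set (set Omega) :=
  <<s \bigcup_(j in D) preimage_set_system setT (Y j) measurable >>.

(* A real number, equal to 0 when [B] is null. *)
Definition cprob (R : realType) d (Omega : measurableType d)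
    (P : probability Omega R) (A B : set Omega) : R :=
  fine (P (A `&` B)) / fine (P B).

(* [f] is a version of the conditional probability of [A] given [Z = z], as a
   function of [z]. *)
Definition cond_prob_version (R : realType) d (Omega : measurableType d)
    d' (E : measurableType d') (P : probability Omega R) (Z : Omega -> E)
    (A : set Omega) (f : E -> R) : Prop :=
  [/\ measurable_fun setT f, forall z, 0 <= f z <= 1 &
      forall C : set E, measurable C ->
        P (A `&` Z @^-1` C) = (\int[P]_(w in Z @^-1` C) (f (Z w))%:E)%E].

Definition cond_independent (R : realType) d (Omega : measurableType d)
    d' (E : measurableType d') (P : probability Omega R) (Z : Omega -> E)
    (G1 G2 : set (set Omega)) : Prop :=
  forall A B, G1 A -> G2 B ->
    exists f g : E -> R,
      [/\ cond_prob_version P Z A f, cond_prob_version P Z B g &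
          cond_prob_version P Z (A `&` B) (f \* g)].

Section MarkovProcess.
Context {R : realType} (k : time_kind) {E : pseudoPMetricType R}
        {d : measure_display} {Omega : measurableType d}.
Implicit Types (F : R -> set (set Omega)) (X : R -> Omega -> borel E)
  (tau : Omega -> \bar R) (U : set E).

Definition filtration F : Prop :=
  [/\ forall t, times k t -> sigma_algebra setT (F t),
      forall t, times k t -> F t `<=` measurable &
      forall s t, times k s -> times k t -> s <= t -> F s `<=` F t].

Definition time_valued tau : Prop :=
  forall w, tau w = +oo%E \/ exists2 t : R, times k t & tau w = t%:E.

Definition stopping_time F tau : Prop :=
  time_valued tau /\
  forall t, times k t -> F t [set w | (tau w <= t%:E)%E].

Definition stopped_sigma F tau : set (set Omega) :=
  [set A | measurable A /\
     forall t, times k t -> F t (A `&` [set w | (tau w <= t%:E)%E])].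

(* [P mu] is the law of the process started from the distribution [mu], and
   [p t] its transition kernel over a time [t]. *)
Record strong_markov F X (P : probability (borel E) R -> probability Omega R)
    (p : R -> R.-pker (borel E) ~> (borel E)) : Prop := {
  sm_filtration : filtration F ;
  sm_adapted : forall t, times k t -> forall B : set (borel E),
    measurable B -> F t (X t @^-1` B) ;
  sm_cadlag : forall w, @cadlag R k E (X ^~ w) ;
  sm_initial : forall mu (B : set (borel E)), measurable B ->
    P mu (X 0 @^-1` B) = mu B ;
  sm_markov : forall mu s t, times k s -> times k t ->
    forall A (B : set (borel E)), F s A -> measurable B ->
    P mu (A `&` X (s + t) @^-1` B) = (\int[P mu]_(w in A) p t (X s w) B)%E ;
  sm_strong_markov : forall mu tau t, stopping_time F tau -> times k t ->
    forall A (B : set (borel E)), stopped_sigma F tau A -> measurable B ->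
    P mu [set w | [/\ A w, (tau w < +oo)%E & B (X (fine (tau w) + t) w)]] =
    (\int[P mu]_(w in A `&` [set w | (tau w < +oo)%E])
        p t (X (fine (tau w)) w) B)%E }.

Definition exit_time U X (w : Omega) : \bar R :=
  ereal_inf [set t%:E | t in [set t | times k t /\ ~ U (X t w)]].

(* The infimum over strictly positive times. *)
Definition exit_time_pos U X (w : Omega) : \bar R :=
  ereal_inf [set t%:E | t in [set t | [/\ times k t, 0 < t & ~ U (X t w)]]].

(* Since [_ / 0 = 0], taking [A = U] forces the conditioning events to have
   positive probability. *)
Definition is_qsd X (P : probability (borel E) R -> probability Omega R)
    U (rho : probability (borel E) R) : Prop :=
  rho U = 1%E /\
  forall t, times k t -> forall A : set (borel E), measurable A -> A `<=` U ->
    rho A = (cprob (P rho) (X t @^-1` A)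
                   [set w | (t%:E < exit_time U X w)%E])%:E.

Definition qsd_assumption X
    (P : probability (borel E) R -> probability Omega R)
    U (rho : probability (borel E) R) : Prop :=
  [/\ is_qsd X P U rho,
      forall rho' : probability (borel E) R, is_qsd X P U rho' ->
        forall A, measurable A -> rho' A = rho A &
      forall mu : probability (borel E) R, mu U = 1%E ->
        forall A : set (borel E), measurable A -> A `<=` U ->
        cprob (P mu) (X t @^-1` A)
              [set w | forall s, times k s -> s <= t -> U (X s w)]
          @[t --> within (times k) +oo] --> fine (rho A)].

End MarkovProcess.

(* The sigma-algebra on pairs (path, time) with respect to which laws are
   compared: the product of the cylinder sigma-algebra and the Borel one. *)
Definition path_time_sigma (R : realType) (k : time_kind)
    (E : pseudoPMetricType R) : set (set ((R -> borel E) * \bar R)) :=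
  <<s [set A |
               (exists2 t, times k t & exists2 B : set (borel E),
                  measurable B & A = [set x | B (x.1 t)]) \/
               (exists2 B : set (\bar R),
                  measurable B & A = [set x | B x.2])] >>.

(* [(Y, S)] has the law of [(X, T)], where [T] is the exit time from [U], for
   some distribution [mu] of [X 0]; [mu] is then the distribution of [Y 0]. *)
Definition is_copy (R : realType) (k : time_kind) (E : pseudoPMetricType R)
    d (Omega : measurableType d) (X : R -> Omega -> borel E)
    (P : probability (borel E) R -> probability Omega R) (U : set E)
    d' (Omega' : measurableType d') (P' : probability Omega' R)
    (Y : R -> Omega' -> borel E) (S : Omega' -> \bar R) : Prop :=
  [/\ forall w, @cadlag R k E (Y ^~ w),
      forall t, times k t -> measurable_fun setT (Y t),
      time_valued k S, measurable_fun setT S &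
      exists mu : probability (borel E) R,
        forall A, path_time_sigma k A ->
          P' [set w | A (Y ^~ w, S w)] =
          P mu [set w | A (X ^~ w, exit_time k U X w)]].

Section ParallelStep.
Context {R : realType} {E : pseudoPMetricType R}
        {d : measure_display} {Omega : measurableType d}.
Variables (X : nat -> R -> Omega -> borel E) (T : nat -> Omega -> \bar R)
          (t : nat -> R).

(* [None] stands for the infimum of the empty set. *)
Definition par_index (w : Omega) : option nat :=
  match pselect (exists m, (1 <= m)%N && (T m w <= (t m)%:E)%E) with
  | left h => Some (ex_minn h)
  | right _ => None
  end.

Definition par_time (w : Omega) : \bar R :=
  if par_index w is Some L
  then ((\sum_(1 <= m < L) t m)%:E + T L w)%E else +oo%E.

Definition par_exit (w : Omega) : borel E :=
  if par_index w is Some L then X L (fine (T L w)) w else point.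

End ParallelStep.

(* Main.v *)
(* A Markov path is determined in law by its initial law, so the process starts
   afresh from rho in two situations. Under P rho, conditionally on T > r, the
   shifted path (X (r + u), T - r) has the law of (X, T) started from rho, since rho
   is quasistationary. Conditionally on the survival of the copies 1, ..., m - 1, so
   has (X_m, T_m): survival only reweights X_m by a function of X_m 0, by conditional
   independence, which keeps it Markov, and its initial law becomes rho. Cutting
   ]0, +oo[ at the times s_m = t_1 + ... + t_m, both sides split into terms that
   agree one by one; nothing escapes as s_m tends to infinity and T is finite.

   The exit time need not be a measurable function of the path, nor {T > r} an event of
   the filtration: both are so only up to null sets. This is shown by exhaustion,
   taking the essentially largest measurable function of the path below T. *)

Require Import Defs.
From HB Require Import structures.
From mathcomp Require Import all_boot all_order all_algebra.
From mathcomp Require Import all_classical all_reals all_analysis.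
From mathcomp Require Import measurable_realfun.

Set Implicit Arguments.
Unset Strict Implicit.
Unset Printing Implicit Defensive.

Import Order.TTheory GRing.Theory Num.Theory.
Import numFieldNormedType.Exports.

Local Open Scope classical_set_scope.
Local Open Scope ring_scope.

(** * Time sets, right-continuous paths and exit times *)

(** A càdlàg path may approach the complement of [U] from the left and jump back inside [U]. The
    supremum of the hitting times of shrinking neighbourhoods can then fall short of the exit time,
    and resuming the search from there may have to be repeated transfinitely. Exhaustion avoids
    this: a single measurable step strictly raises any minorant wherever it is still below the exit
    time, so one of maximal size already equals it almost everywhere. The graph of the exit time
    need not be measurable, and the law of a copy is given on cylinder and time events only, so
    being carried by the graph is expressed through null sets ([exit_concentrated]). Applied to the
    sum of two laws of pairs (path, time), exhaustion yields one function of the path that is the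
    time under both; equality of the path laws then gives equality of the laws of the pairs. *)

Section Times.
Context {R : realType} (k : time_kind).

Lemma times0 : times k (0 : R).
Proof. by case: k => /=; [exists 0%N|]. Qed.

Lemma times_ge0 (t : R) : times k t -> 0 <= t.
Proof. by case: k => //= -[n ->]. Qed.

Lemma timesD (s t : R) : times k s -> times k t -> times k (s + t).
Proof.
case: k => /=; last by move=> *; exact: addr_ge0.
by move=> [n ->] [m ->]; exists (n + m)%N; rewrite natrD.
Qed.

Lemma timesB (s t : R) : times k s -> times k t -> s <= t -> times k (t - s).
Proof.
case: k => /=; last by move=> *; rewrite subr_ge0.
move=> [n ->] [m ->]; rewrite ler_nat => nm.
by exists (m - n)%N; rewrite natrB.
Qed.

Lemma times_min (s t : R) : times k s -> times k t -> times k (Num.min s t).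
Proof. by move=> ? ?; case: (leP s t). Qed.

Lemma measurable_times : measurable (times k : set R).
Proof.
case: k => /=; last first.
  by rewrite (_ : [set t | 0 <= t] = `[0, +oo[%classic) //; apply/seteqP; split => x /=;
    rewrite in_itv /= andbT.
rewrite (_ : [set t : R | _] = \bigcup_n [set n%:R : R]); last first.
  by apply/seteqP; split => [x [n ->]|x [n _ ->]]; [exists n|exists n].
exact: bigcup_measurable.
Qed.

(** Approximation is from the right, as only right-continuity is exploited; [t] itself is allowed
    because discrete times admit no other approximation. *)
Lemma countable_dense_times : exists q : nat -> R,
  (forall n, times k (q n)) /\
  (forall t, times k t -> forall e, 0 < e -> exists n, t <= q n < t + e).
Proof.
case: k => /=.
  exists (fun n => n%:R); split=> [n|_ [n ->] e e0]; first by exists n.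
  by exists n; rewrite lexx ltrDl.
exists (fun n => if unpickle n is Some (a, b) then a%:R / b.+1%:R else 0).
split=> [n|t t0 e e0].
  by case: unpickle => // -[a b]; exact: divr_ge0.
have [_ /andP[_]] : True /\ (Num.truncn e^-1)%:R <= e^-1 < (Num.truncn e^-1).+1%:R.
  by split=> //; apply: truncn_itv; rewrite invr_ge0 ltW.
set b := Num.truncn _ => be.
have b0 : 0 < b.+1%:R :> R by rewrite ltr0n.
have tb0 : 0 <= t * b.+1%:R by rewrite mulr_ge0// ltW.
have := truncn_itv tb0; set a := Num.truncn _ => /andP[ha1 ha2].
(* The denominator exceeds 1 / [e] and the numerator is the least integer above [t * b.+1%:R], so
   the fraction overshoots [t] by at most 1 / (b + 1). *)
exists (pickle (a.+1, b)); rewrite pickleK ler_pdivlMr// (ltW ha2)/=.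
rewrite ltr_pdivrMr// mulrDl -natr1.
apply: ler_ltD => //.
by rewrite -ltr_pdivrMl// mulr1.
Qed.

End Times.

Section RightContinuousPaths.
Context {R : realType} (k : time_kind) {E : pseudoPMetricType R}.
Implicit Types (x : R -> E) (U : set E).

(* Every path satisfies this at discrete times (take [e = 1]), so that one notion
   serves both kinds of time. *)
Definition rc_path x := forall t, times k t ->
  forall V, nbhs (x t) V -> exists2 e : R, 0 < e &
    forall u, times k u -> t <= u < t + e -> V (x u).

Lemma discrete_times_eq (n : nat) (u : R) :
  times Discrete u -> n%:R <= u < n%:R + 1 -> u = n%:R.
Proof.
move=> [m ->]; rewrite ler_nat natr1 ltr_nat ltnS => /andP[nm mn].
by congr (_%:R); apply/eqP; rewrite eqn_leq nm mn.
Qed.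

Lemma cadlag_rc_path x : cadlag k x -> rc_path x.
Proof.
rewrite /rc_path; case: k => cx t tt V Vxt.
  case: tt Vxt => n -> Vxt; exists 1 => // u tu nu.
  by rewrite (discrete_times_eq tu nu); exact: nbhs_singleton.
have [/(_ V Vxt) + _] := cx t tt.
rewrite /= /nbhs/= /at_right /within /= => -[e /= e0 he].
exists e => // u u0 /andP[tu ue].
move: tu; rewrite le_eqVlt => /predU1P[<-|tu]; first exact: nbhs_singleton.
apply: he => //=.
by rewrite /ball_ /= distrC gtr0_norm ?subr_gt0// ltrBlDl.
Qed.

(* The balls of a [pseudoPMetricType] need not be open, hence the interiors. *)
Definition nhood U (n : nat) : set E :=
  \bigcup_(c in ~` U) (ball c n.+1%:R^-1)^°.

Lemma open_nhood U n : open (nhood U n).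
Proof. by apply: bigcup_open => c _; exact: open_interior. Qed.

Lemma sub_nhood U n c : ~ U c -> nhood U n c.
Proof.
by move=> Uc; exists c => //; apply: nbhsx_ballx; rewrite invr_gt0.
Qed.

(** If the balls of radius 1 / (n + 1) around [y] and around a point [c] outside [U] meet, then [c]
    is within 2 / (n + 1) of [y]; for large [n] that would put [c] in [U]. *)
Lemma nhood_avoid U y : open U -> U y ->
  exists n, nbhs y (~` nhood U n).
Proof.
move=> oU Uy; have : nbhs y U by exact: open_nbhs_nbhs.
rewrite nbhs_ballP => -[e /= e0 ye].
have e20 : 0 < e / 2 by rewrite divr_gt0.
have [n _ hn] : \forall n \near \oo, n.+1%:R^-1 < e / 2.
  exact: near_infty_natSinv_lt (PosNum e20).
exists n; rewrite nbhs_ballP; exists n.+1%:R^-1 => /=; first by rewrite invr_gt0.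
move=> z yz [c Uc /interior_subset cz]; apply: Uc; apply: ye.
apply: (@le_ball _ _ _ (n.+1%:R^-1 + n.+1%:R^-1)).
  by rewrite [leRHS]splitr lerD// ltW//; exact: (hn n (leqnn n)).
by apply: ball_triangle yz _; exact: ball_sym.
Qed.

(** Here [s] need not be a time, since it will be the value of a minorant. At discrete times the
    position at the integer part of [s] decides, and the window ends at the next integer. *)
Lemma nhood_gap U x (s : R) : open U -> rc_path x -> 0 <= s ->
  (forall u, times k u -> u <= s -> U (x u)) ->
  exists n, exists2 e : R, 0 < e &
    forall u, times k u -> s <= u < s + e -> ~ nhood U n (x u).
Proof.
rewrite /rc_path; case: k => oU rx s0 Ux.
  have /andP[ms sm] := truncn_itv s0; set m := Num.truncn s in ms sm *.
  have Um : U (x m%:R) by apply: Ux => //; exists m.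
  have [n Vn] := nhood_avoid oU Um; exists n.
  exists (m.+1%:R - s); first by rewrite subr_gt0.
  move=> u tu /andP[su um]; rewrite (@discrete_times_eq m u tu).
    exact: (nbhs_singleton Vn).
  by rewrite (le_trans ms su)/= natr1; move: um; rewrite addrC subrK -natr1.
have [n Vn] := nhood_avoid oU (Ux s s0 (lexx s)); exists n.
by have [e e0 he] := rx s s0 _ Vn; exists e.
Qed.

End RightContinuousPaths.

Section ExitTimes.
Context {R : realType} (k : time_kind) {E : pseudoPMetricType R}.
Implicit Types (x : R -> E) (U : set E).

Lemma rc_path_shift x t : times k t -> rc_path k x ->
  rc_path k (fun s => x (t + s)).
Proof.
move=> tt rx s ts V Vx; have [e e0 he] := rx _ (timesD tt ts) V Vx.
exists e => // u tu /andP[su us]; apply: he; first exact: timesD.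
by rewrite lerD2l su -addrA ltrD2l.
Qed.

Lemma rc_path_stop x t : times k t -> rc_path k x ->
  rc_path k (fun s => x (Num.min s t)).
Proof.
move=> tt rx s ts V Vx; have [e e0 he] := rx _ (times_min ts tt) V Vx.
exists e => // u tu /andP[su us]; apply: he; first exact: times_min.
by rewrite le_min !ge_min su lexx orbT/= addr_minl lt_min !gt_min us ltrDl e0 orbT.
Qed.

Definition path_exit U x : \bar R :=
  ereal_inf [set t%:E | t in [set t | times k t /\ ~ U (x t)]].

Lemma path_exit_ge0 U x : (0 <= path_exit U x)%E.
Proof.
by apply/ereal_infP => _ /= [t [tt _] <-]; rewrite lee_fin (times_ge0 tt).
Qed.

Lemma path_exit_le U x t : times k t -> ~ U (x t) -> (path_exit U x <= t%:E)%E.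
Proof. by move=> tt Ux; apply: ereal_inf_lbound; exists t. Qed.

Lemma path_exit_gt U x t s : times k s -> s <= t -> (t%:E < path_exit U x)%E ->
  U (x s).
Proof.
move=> ts st tx; apply: contrapT => /(@path_exit_le U x _ ts); apply/negP.
by rewrite -ltNge (le_lt_trans _ tx)// lee_fin.
Qed.

(** The complement of [U] is closed: a path in [U] up to and including the infimum would stay in [U]
    a little longer, by right-continuity. *)
Lemma path_exit_attained U x : open U -> rc_path k x ->
  path_exit U x = +oo%E \/
  exists t, [/\ times k t, path_exit U x = t%:E & ~ U (x t)].
Proof.
move=> oU rx; case xT : (path_exit U x) => [r| |]; last 2 first.
- by left.
- by have := path_exit_ge0 U x; rewrite xT.
right; have r0 : 0 <= r by rewrite -lee_fin -xT path_exit_ge0.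
have [[u [tu ur Ux]]|noexit] :=
    pselect (exists u, [/\ times k u, u <= r & ~ U (x u)]).
  have : (path_exit U x <= u%:E)%E by exact: path_exit_le.
  rewrite xT lee_fin => ru.
  by exists u; split => //; congr _%:E; apply/le_anti; rewrite ru.
have [|n [e e0 he]] := nhood_gap oU rx r0.
  by move=> u tu ur; apply: contrapT => Ux; apply: noexit; exists u.
have : (r%:E < (r + e)%:E)%E by rewrite lte_fin ltrDl.
rewrite -[in ltLHS]xT => /ereal_inf_lt[_ [u [tu Ux] <-]]; rewrite lte_fin => ure.
have ru : r <= u by rewrite -lee_fin -xT; exact: path_exit_le.
by have := he u tu; rewrite ru ure => /(_ isT) []; exact: sub_nhood.
Qed.

Lemma path_exit_gtP U x t : open U -> rc_path k x ->
  (forall s, times k s -> s <= t -> U (x s)) -> (t%:E < path_exit U x)%E.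
Proof.
move=> oU rx Ux; have [->|[u [tu -> Uxu]]] := path_exit_attained oU rx.
  exact: ltry.
by rewrite lte_fin ltNge; apply/negP => /(Ux _ tu).
Qed.

Lemma path_exit_shift U x t : open U -> rc_path k x -> times k t ->
  (t%:E < path_exit U x)%E ->
  path_exit U (fun s => x (t + s)) = (path_exit U x - t%:E)%E.
Proof.
move=> oU rx tt tx; apply/eqP; rewrite eq_le; apply/andP; split; last first.
  apply/ereal_infP => _ /= [s [ts Ux] <-].
  by rewrite EFinN leeBlDr// -EFinD addrC; apply: path_exit_le => //; exact: timesD.
have [->|[u [tu xu Ux]]] := path_exit_attained oU rx.
  by rewrite addye ?leey.
rewrite xu -EFinB; rewrite xu lte_fin in tx.
apply: path_exit_le; first by apply: timesB => //; exact: ltW.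
by rewrite addrC subrK.
Qed.

(** The path stopped at [t] involves no value after [t], yet its exit time still tells whether the
    exit occurs by [t]. *)
Lemma path_exit_stop U x t : open U -> rc_path k x -> times k t ->
  path_exit U (fun s => x (Num.min s t)) =
  if (path_exit U x <= t%:E)%E then path_exit U x else +oo%E.
Proof.
move=> oU rx tt; case: ifPn => [xt|]; last first.
  rewrite -ltNge => xt; apply/eqP; rewrite eq_le leey/=.
  apply/ereal_infP => _ /= [s [ts Ux] <-]; exfalso; apply: Ux.
  by apply: path_exit_gt xt; [exact: times_min|rewrite ge_min lexx orbT].
apply/eqP; rewrite eq_le; apply/andP; split.
  have [xoo|[u [tu xu Ux]]] := path_exit_attained oU rx.
    by rewrite xoo in xt.
  rewrite xu; rewrite xu lee_fin in xt.
  by apply: path_exit_le => //; rewrite min_l.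
apply/ereal_infP => _ /= [s [ts Ux] <-].
apply: (@le_trans _ _ (Num.min s t)%:E); last by rewrite lee_fin ge_min lexx.
by apply: path_exit_le => //; exact: times_min.
Qed.

End ExitTimes.

(** * The path space *)

Section PathSpace.
Context {R : realType} (k : time_kind) {E : pseudoPMetricType R}.

(* The sets containing no right-continuous path are included so that exit times
   and evaluation at random times become measurable on the whole path space. *)
Definition path_generators : set (set (R -> borel E)) :=
  [set A | (exists s : seq R, exists2 B : R -> set (borel E),
             (forall t, t \in s -> times k t /\ measurable (B t)) &
             A = [set x | forall t, t \in s -> B t (x t)]) \/
           (forall x, rc_path k x -> ~ A x)].

End PathSpace.

Notation pathT k E := (g_sigma_algebraType (@path_generators _ k E)).

Section PathSpaceTheory.
Context {R : realType} (k : time_kind) {E : pseudoPMetricType R}.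

Lemma path_generators_setI : setI_closed (@path_generators R k E).
Proof.
have mimp (b : bool) (C : set (borel E)) : (b -> measurable C) ->
    measurable [set y | b -> C y].
  case: b => mC; last by rewrite (_ : [set _ | _] = setT)//; apply/seteqP.
  have := mC isT; congr measurable.
  by apply/seteqP; split => y //= /(_ isT).
move=> A A' [[s [B mB ->]]|nA] GA'; last by right => x /nA + [].
case: GA' => [[s' [B' mB' ->]]|nA']; last by right => x /nA' + [].
left; exists (s ++ s').
exists (fun t => [set y | (t \in s -> B t y) /\ (t \in s' -> B' t y)]).
  move=> t; rewrite mem_cat => ts; split.
    by case/orP: ts => [/mB[]|/mB'[]].
  by apply: measurableI; apply: mimp; [move=> /mB[]|move=> /mB'[]].
apply/seteqP; split => x /=.
  by move=> [h h'] t _; split => ts; [exact: h|exact: h'].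
move=> h; split => t ts; have := h t; rewrite mem_cat ts ?orbT => /(_ isT) [].
  by move=> + _; exact.
by move=> _; exact.
Qed.

Lemma measurable_no_rc_path (A : set (pathT k E)) :
  (forall x, rc_path k x -> ~ A x) -> measurable A.
Proof. by move=> nA; apply: sub_sigma_algebra; right. Qed.

Lemma measurable_rc_path :
  measurable [set x : pathT k E | rc_path k x].
Proof.
rewrite -[X in measurable X]setCK; apply: measurableC.
by apply: measurable_no_rc_path => x rx; exact.
Qed.

Lemma measurable_coord t : times k t ->
  measurable_fun setT (fun x : pathT k E => x t : borel E).
Proof.
move=> tt _ B mB; rewrite setTI; apply: sub_sigma_algebra; left.
exists [:: t]; exists (fun=> B) => [u|]; first by rewrite inE => /eqP ->.
apply/seteqP; split => x /=; last by apply; rewrite inE.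
by move=> Bx u; rewrite inE => /eqP ->.
Qed.

(** The sigma-algebra [G] is arbitrary so that the lemma also serves for [F r] and for the
    sigma-algebra generated by a copy. *)
Lemma path_preimage (T : Type) (G : set (set T)) (Y : R -> T -> borel E) :
  sigma_algebra setT G -> (forall w, rc_path k (Y ^~ w)) ->
  (forall t, times k t -> forall B, measurable B -> G (Y t @^-1` B)) ->
  forall B : set (pathT k E), measurable B -> G [set w | B (Y ^~ w)].
Proof.
move=> sG rY GY.
suff sub : <<s @path_generators _ k E >> `<=`
    image_set_system setT (fun w => Y ^~ w) G.
  by move=> B /sub; rewrite /image_set_system/= setTI.
apply: smallest_sub; first exact: sigma_algebra_image.
move=> A; have [G0 GC GU] := sG.
case=> [[s [B' mB' ->]]|nA]; last first.
  rewrite /image_set_system/= setTI (_ : _ @^-1` _ = set0)//.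
  by apply/seteqP; split => w //= /nA; apply; exact: rY.
rewrite /image_set_system/= setTI.
elim: s mB' => [|t s ih] mB'.
  rewrite (_ : _ @^-1` _ = setT `\` set0); first exact: GC.
  by apply/seteqP; split => [w _|w _ u]//=; split.
rewrite (_ : _ @^-1` _ =
    Y t @^-1` B' t `&` [set w | forall t, t \in s -> B' t (Y t w)]); last first.
  apply/seteqP; split => w /=.
    move=> h; split; first by apply: h; rewrite inE eqxx.
    by move=> u us; apply: h; rewrite inE us orbT.
  by move=> [h1 h2] u; rewrite inE => /predU1P[->//|]; exact: h2.
have [|_ _ _ GI] := (sigma_algebraP (U := setT) (C := G) _).1 sG; first by [].
apply: GI; first by have [tt mB] := mB' t (mem_head _ _); exact: GY.
by apply: ih => u us; apply: mB'; rewrite inE us orbT.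
Qed.

Lemma measurable_path d (T : measurableType d) (Y : R -> T -> borel E) :
  (forall w, rc_path k (Y ^~ w)) ->
  (forall t, times k t -> measurable_fun setT (Y t)) ->
  measurable_fun setT (fun w => Y ^~ w : pathT k E).
Proof.
move=> rY mY _ B mB; rewrite setTI.
apply: (path_preimage (G := measurable)) mB => //.
  exact: sigma_algebra_measurable.
by move=> t tt C mC; rewrite -[_ @^-1` _]setTI; exact: mY.
Qed.

End PathSpaceTheory.

(** * The exit time as a function of the path, up to null sets *)

Section ExitFunctional.
Context {R : realType} (k : time_kind) {E : pseudoPMetricType R}.
Variable U : set E.
Hypothesis oU : open U.

Lemma measurable_open (V : set E) : open V -> measurable (V : set (borel E)).
Proof. exact: sub_sigma_algebra. Qed.

Definition exit_minorant (f : pathT k E -> \bar R) := [/\ measurable_fun setT f,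
  forall x, (0 <= f x)%E &
  forall x, rc_path k x -> (f x <= path_exit k U x)%E].

(** Since [einfs _ 0] is the infimum of the whole sequence, this is the hitting time of [nhood U n]
    from time [f x] on, searched along the countable set of the [q j]. *)
Definition hitting_after (q : nat -> R) (f : pathT k E -> \bar R) n x : \bar R :=
  einfs (fun j => if `[< (f x <= (q j)%:E)%E /\ nhood U n (x (q j)) >]
                  then (q j)%:E else +oo%E) 0%N.

Definition raise_minorant q f (x : pathT k E) : \bar R :=
  esups (hitting_after q f ^~ x) 0%N.

Lemma esups0_ge (u : nat -> \bar R) n : (u n <= esups u 0%N)%E.
Proof. by apply: ereal_sup_ubound; exists n. Qed.

Lemma esups0_le (u : nat -> \bar R) a : (forall n, u n <= a)%E -> (esups u 0%N <= a)%E.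
Proof. by move=> ua; apply: ge_ereal_sup => _ [n _ <-]. Qed.

Lemma einfs0_le (u : nat -> \bar R) n : (einfs u 0%N <= u n)%E.
Proof. by apply: ereal_inf_lbound; exists n. Qed.

Lemma einfs0_ge (u : nat -> \bar R) a : (forall n, a <= u n)%E -> (a <= einfs u 0%N)%E.
Proof. by move=> ua; apply/ereal_infP => _ [n _ <-]. Qed.

Section Raise.
Variables (q : nat -> R) (f : pathT k E -> \bar R).
Hypotheses (tq : forall n, times k (q n))
  (dq : forall t, times k t -> forall e, 0 < e -> exists n, t <= q n < t + e)
  (mf : exit_minorant f).

Lemma raise_minorant_ge x : (f x <= raise_minorant q f x)%E.
Proof.
apply: le_trans (esups0_ge _ 0); apply: einfs0_ge => j.
by case: ifPn => [/asboolP[]|_] //; rewrite leey.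
Qed.

(** The exit time is not exceeded: right after it the path still lies in every [nhood U n], these
    being open, and some [q j] falls there. *)
Lemma raise_minorantP : exit_minorant (raise_minorant q f).
Proof.
have [mf' f0 fx] := mf; split.
- apply: measurable_fun_esups => n; apply: measurable_fun_einfs => j.
  apply: measurable_fun_ifT => //; apply: (measurable_fun_bool true).
  rewrite setTI (_ : _ @^-1` _ = [set x | (f x <= (q j)%:E)%E] `&`
      (fun x : pathT k E => x (q j) : borel E) @^-1` nhood U n); last first.
    by apply/seteqP; split => x /=; [move/asboolP|move=> ?; apply/asboolP].
  apply: measurableI; first by rewrite -[X in measurable X]setTI; exact: emeasurable_fun_infty_c.
  rewrite -[X in measurable X]setTI; apply: (@measurable_coord _ _ _ _ (tq j)) => //.
  exact: measurable_open (open_nhood U n).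
- by move=> x; exact: le_trans (raise_minorant_ge x).
- move=> x rx; apply: esups0_le => n.
  have [->|[t [tt xt Ux]]] := path_exit_attained oU rx; first exact: leey.
  rewrite xt; apply/lee_addgt0Pr => e e0.
  have nV : nbhs (x t) (nhood U n).
    by apply: open_nbhs_nbhs; split; [exact: open_nhood|exact: sub_nhood].
  have [e' e'0 he] := rx t tt _ nV.
  have ee0 : 0 < Num.min e e' by rewrite lt_min e0.
  have [j /andP[tj]] := dq tt ee0; rewrite -ltrBlDl lt_min !ltrBlDl => /andP[je je'].
  apply: (le_trans (einfs0_le _ j)); rewrite ifT; last first.
    apply/asboolP; split; last by apply: he => //; rewrite tj.
    by rewrite (le_trans (fx _ rx))// xt lee_fin.
  by rewrite -EFinD lee_fin ltW.
Qed.

(** By [nhood_gap] the path avoids some [nhood U n] on a window of length [e] starting at [f x], so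
    the search at level [n] succeeds no earlier than [f x + e]. *)
Lemma raise_minorant_gt x : rc_path k x -> (f x < path_exit k U x)%E ->
  (f x < raise_minorant q f x)%E.
Proof.
have [_ f0 _] := mf; move=> rx fx.
have fE : f x = (fine (f x))%:E.
  by rewrite fineK// ge0_fin_numE// (lt_le_trans fx)// leey.
have s0 : 0 <= fine (f x) by exact: fine_ge0.
rewrite fE in fx *; move: (fine (f x)) fE s0 fx => s fE s0 sx.
have [|n [e e0 he]] := nhood_gap oU rx s0.
  by move=> u tu us; exact: path_exit_gt sx.
apply: lt_le_trans (esups0_ge _ n).
apply: (@lt_le_trans _ _ (s + e)%:E); first by rewrite lte_fin ltrDl.
apply: einfs0_ge => j; case: ifPn => [/asboolP[]|_]; last exact: leey.
rewrite fE !lee_fin => sj; apply: contraPT; rewrite -ltNge => je.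
by apply: he => //; rewrite sj.
Qed.

End Raise.

Lemma exit_minorant_sup (g : nat -> pathT k E -> \bar R) :
  (forall n, exit_minorant (g n)) -> exit_minorant (fun x => esups (g ^~ x) 0%N).
Proof.
move=> mg; split.
- by apply: measurable_fun_esups => n; have [] := mg n.
- by move=> x; apply: le_trans (esups0_ge _ 0%N); have [] := mg 0%N.
- by move=> x rx; apply: esups0_le => n; have [_ _] := mg n; exact.
Qed.

(** The graph may fail to be measurable, so full mass cannot be demanded of it; instead measurable
    sets missing it must be null. [N] is a mere function, so that expressions not packaged as
    measures are allowed. *)
Definition exit_concentrated
    (N : set (pathT k E * \bar R) -> \bar R) :=
  forall B : set (pathT k E * \bar R), measurable B ->
  (forall x, rc_path k x -> ~ B (x, path_exit k U x)) -> N B = 0%E.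

Lemma measurable_minorant_gt f (r : R) : exit_minorant f ->
  measurable [set z : pathT k E * \bar R | (r%:E < f z.1)%E].
Proof.
move=> [mf _ _]; rewrite -[X in measurable X]setTI.
by apply: emeasurable_fun_o_infty => //; exact: measurableT_comp.
Qed.

(* An exhaustion argument: a minorant of the exit time maximising the mass of
   [r < f] for all rational [r] cannot be raised any further. *)
Lemma exit_functional (N : {measure set (pathT k E * \bar R)%type -> \bar R}) :
  (N setT < +oo)%E -> exit_concentrated N ->
  exists2 f : pathT k E -> \bar R, measurable_fun setT f &
    N [set z | f z.1 != z.2] = 0%E.
Proof.
move=> Nfin Ngraph.
have [q [tq dq]] := @countable_dense_times R k.
(* Levels dense in the whole half-line, whatever the kind of time, to separate distinct values of
   two minorants. *)
have [r [r0 dr]] := @countable_dense_times R Defs.Continuous.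
pose M f n := N [set z | ((r n)%:E < f z.1)%E].
pose c n := ereal_sup [set M f n | f in exit_minorant].
have Mfin f n : exit_minorant f -> M f n \is a fin_num.
  move=> mf; rewrite ge0_fin_numE// (le_lt_trans _ Nfin)// le_measure ?inE//.
  exact: measurable_minorant_gt.
have zmin : exit_minorant (fun=> 0%E).
  by split => // x _; exact: path_exit_ge0.
have cfin n : c n \is a fin_num.
  rewrite ge0_fin_numE.
    apply: le_lt_trans Nfin; apply: ge_ereal_sup => _ [f mf <-].
    by rewrite le_measure ?inE//; exact: measurable_minorant_gt.
  apply: (@le_trans _ _ (M (fun=> 0%E) n)) => //.
  by apply: ereal_sup_ubound; exists (fun=> 0%E).
(* For the pair (n, m), a minorant whose mass above level [r n] is within 1 / (m + 1) of the
   supremum [c n]. The supremum [f] of all of them is then optimal at every level at once. *)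
have hF nm : exists f, exit_minorant f /\ (c nm.1 - (nm.2.+1%:R^-1)%:E < M f nm.1)%E.
  have e0 : 0 < nm.2.+1%:R^-1 :> R by rewrite invr_gt0.
  have [_ [f mf <-] hf] := ub_ereal_sup_adherent e0 (cfin nm.1).
  by exists f.
have [F FP] := choice hF.
pose g j x := F (if unpickle j is Some nm then nm else (0, 0)%N) x.
pose f x := esups (g ^~ x) 0%N.
have mf : exit_minorant f by apply: exit_minorant_sup => j; exact: (FP _).1.
have cf n : (c n <= M f n)%E.
  apply/lee_addgt0Pr => e e0.
  have [m _ hm] : \forall m \near \oo, m.+1%:R^-1 < e.
    exact: near_infty_natSinv_lt (PosNum e0).
  have {hm} := hm m (leqnn m) => /= hm.
  have [mF] := FP (n, m); rewrite /= EFinN lteBlDr// => /ltW/le_trans; apply.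
  apply: leeD; last by rewrite lee_fin ltW.
  rewrite le_measure ?inE//; [exact: measurable_minorant_gt..|].
  move=> z /= /lt_le_trans; apply.
  by have := esups0_ge (g ^~ z.1) (pickle (n, m)); rewrite /g pickleK.
have mf' := raise_minorantP tq dq mf; set f' := raise_minorant q f in mf'.
have ff' x : (f x <= f' x)%E := raise_minorant_ge q f x.
have mfm : measurable_fun setT (fun z : pathT k E * \bar R => f z.1).
  by have [? _ _] := mf; exact: measurableT_comp.
have mfm' : measurable_fun setT (fun z : pathT k E * \bar R => f' z.1).
  by have [? _ _] := mf'; exact: measurableT_comp.
(* As [f'] is itself a minorant, its mass above level [r n] cannot exceed [c n], which [f] attains;
   the two nested events differ by a null set. *)
have N0 n : N [set z : pathT k E * \bar R | (f z.1 <= (r n)%:E < f' z.1)%E] = 0%E.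
  have mgt := measurable_minorant_gt (r n) mf.
  have mgt' := measurable_minorant_gt (r n) mf'.
  rewrite (_ : [set z | _] = [set z : pathT k E * \bar R | ((r n)%:E < f' z.1)%E] `\`
      [set z : pathT k E * \bar R | ((r n)%:E < f z.1)%E]); last first.
    apply/seteqP; split => z /=; first by move=> /andP[? ?]; split=> //; apply/negP; rewrite -leNgt.
    by move=> [-> /negP]; rewrite -leNgt andbT.
  rewrite measureD//; last by rewrite -ge0_fin_numE//; exact: Mfin.
  rewrite setIidr; last by move=> z /= /lt_le_trans; apply.
  rewrite [X in (X - _)%E](_ : _ = M f n); first by rewrite subee// Mfin.
  apply/eqP; rewrite eq_le; apply/andP; split; last first.
    by rewrite le_measure ?inE// => z /= /lt_le_trans; apply.
  by apply: le_trans (cf n); apply: ereal_sup_ubound; exists f'.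
have mlt : measurable [set z : pathT k E * \bar R | (f z.1 < f' z.1)%E].
  by rewrite -[X in measurable X]setTI; exact: measurable_lte.
have Nlt : N [set z : pathT k E * \bar R | (f z.1 < f' z.1)%E] = 0%E.
  have sub : [set z : pathT k E * \bar R | (f z.1 < f' z.1)%E] `<=`
      \bigcup_n [set z : pathT k E * \bar R | (f z.1 <= (r n)%:E < f' z.1)%E].
    move=> z /= zz; have [_ f0 _] := mf.
    have fE : f z.1 = (fine (f z.1))%:E.
      by rewrite fineK// ge0_fin_numE// (lt_le_trans zz)// leey.
    have fz0 : 0 <= fine (f z.1) by exact: fine_ge0.
    case f'E : (f' z.1) zz => [b| |] zz; last by move: zz; rewrite ltNge leNye.
    - rewrite fE lte_fin -subr_gt0 in zz.
      have [n] := dr _ fz0 _ zz; rewrite addrC subrK => hn; exists n => //=.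
      by rewrite fE f'E lee_fin lte_fin.
    - have [n /andP[hn _]] := dr _ fz0 _ ltr01; exists n => //=.
      by rewrite fE f'E lee_fin hn ltry.
  have mU n : measurable [set z : pathT k E * \bar R | (f z.1 <= (r n)%:E < f' z.1)%E].
    rewrite (_ : [set z | _] = [set z : pathT k E * \bar R | (f z.1 <= (r n)%:E)%E] `&`
       [set z : pathT k E * \bar R | ((r n)%:E < f' z.1)%E]); last first.
      by apply/seteqP; split => z /= /andP.
    apply: measurableI; last exact: measurable_minorant_gt mf'.
    by rewrite -[X in measurable X]setTI; exact: emeasurable_fun_infty_c.
  apply/negligibleP => //.
  apply: negligibleS sub _; apply: negligible_bigcup => n.
  by apply/(negligibleP _ (mU n)); exact: N0.
have mne : measurable [set z : pathT k E * \bar R | f z.1 != z.2].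
  by rewrite -[X in measurable X]setTI; apply: measurable_neqe => //.
have mle : measurable [set z : pathT k E * \bar R | (f' z.1 <= f z.1)%E].
  by rewrite -[X in measurable X]setTI; apply: measurable_lee => //.
exists f; first by have [] := mf.
(* This set misses the graph, because raising is strict wherever [f] is below the exit time. *)
have NB : N ([set z | f z.1 != z.2] `&` [set z | (f' z.1 <= f z.1)%E]) = 0%E.
  apply: Ngraph; first exact: measurableI.
  move=> x rx [/= fx]; apply/negP; rewrite -ltNge; apply: raise_minorant_gt => //.
  by have [_ _ /(_ _ rx)] := mf; rewrite le_eqVlt (negbTE fx).
apply/negligibleP => //.
apply: (@negligibleS _ _ _ _ ([set z | (f z.1 < f' z.1)%E] `|`
   ([set z | f z.1 != z.2] `&` [set z | (f' z.1 <= f z.1)%E]))).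
  by move=> z /= fz; case: (ltP (f z.1) (f' z.1)) => ?; [left|right].
apply: negligibleU; apply/negligibleP => //; last exact: measurableI.
Qed.

End ExitFunctional.

(** * Laws of Markov paths *)

Section Density.
Local Open Scope ereal_scope.
Context d1 d2 (T1 : measurableType d1) (T2 : measurableType d2) (R : realType).
Variables (P : {measure set T1 -> \bar R}) (Z : T1 -> T2) (h : T1 -> \bar R)
  (M : {measure set T2 -> \bar R}).
Hypotheses (mZ : measurable_fun setT Z) (mh : measurable_fun setT h)
  (h0 : forall w, 0 <= h w) (hfin : forall w, h w \is a fin_num)
  (Mh : forall C, measurable C -> M C = \int[P]_(w in Z @^-1` C) h w).

Import HBNNSimple.

Let density_nnsfun (f : {nnsfun T2 >-> R}) :
  \int[M]_y (f y)%:E = \int[P]_w ((f (Z w))%:E * h w).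
Proof.
have mA r : measurable (Z @^-1` (f @^-1` [set r])).
  by rewrite -[X in measurable X]setTI; exact: mZ.
have mi r : measurable_fun setT (fun w => (r * \1_(f @^-1` [set r]) (Z w))%:E).
  by apply/measurable_EFinP; apply: measurable_funM => //; exact: measurableT_comp.
transitivity (\sum_(r \in range f) \int[M]_y (r * \1_(f @^-1` [set r]) y)%:E).
  rewrite -ge0_integral_fsum//.
  - by apply: eq_integral => y _; rewrite fsumEFin// -fimfunE.
  - by move=> r; exact/measurable_EFinP/measurable_funM.
  - by move=> r y _; rewrite nnfun_muleindic_ge0.
transitivity (\sum_(r \in range f)
    \int[P]_w ((r * \1_(f @^-1` [set r]) (Z w))%:E * h w)); last first.
  rewrite -ge0_integral_fsum//.
  - apply: eq_integral => w _; rewrite -ge0_mule_fsuml; last first.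
      by move=> r; exact: nnfun_muleindic_ge0.
    by rewrite fsumEFin// -fimfunE.
  - by move=> r; exact: emeasurable_funM.
  - by move=> r w _; rewrite mule_ge0// nnfun_muleindic_ge0.
apply: eq_fsbigr => r _; rewrite integralZl_indic_nnsfun// integral_indic//= setIT Mh//.
have [r0|r0] := ltP r 0%R.
  rewrite preimage_nnfun0// preimage_set0 integral_set0 mule0.
  by rewrite integral0_eq// => w _; rewrite indic0 mulr0 mul0e.
rewrite integral_mkcond -ge0_integralZl//.
- apply: eq_integral => w _; rewrite EFinM -muleA epatch_indic /=.
  by rewrite [X in _ = _ * X]muleC.
- by apply/(measurable_restrictT _ _).1 => //; exact: measurable_funTS.
- by move=> w _; rewrite patchE; case: ifPn.
Qed.

(** The weight [h] need not be a function of [Z]: only its integrals over events generated by [Z]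
    matter. Hence a weight can be exchanged for another with the same image, such as an indicator
    for a conditional probability. *)
Lemma ge0_integral_density (f : T2 -> \bar R) : measurable_fun setT f ->
  (forall y, 0 <= f y) -> \int[M]_y f y = \int[P]_w (f (Z w) * h w).
Proof.
move=> mf f0; pose f_ := nnsfun_approx measurableT mf.
transitivity (limn (fun n => \int[M]_y (f_ n y)%:E)).
  rewrite -monotone_convergence//=.
  - by apply: eq_integral => y _; apply/esym/cvg_lim => //; exact: cvg_nnsfun_approx.
  - by move=> n; exact/measurable_EFinP.
  - by move=> n y _; rewrite lee_fin.
  - by move=> y _ a b ab; rewrite lee_fin; exact/lefP/nd_nnsfun_approx.
transitivity (limn (fun n => \int[P]_w ((f_ n (Z w))%:E * h w))).
  by congr (limn _); apply/funext => n; exact: density_nnsfun.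
rewrite -monotone_convergence//=.
- apply: eq_integral => w _; apply/cvg_lim => //; apply: cvgeZr => //.
  exact: (cvg_nnsfun_approx measurableT mf).
- move=> n; apply: emeasurable_funM => //; apply/measurable_EFinP.
  exact: measurableT_comp.
- by move=> n w _; rewrite mule_ge0// lee_fin.
- move=> w _ a b ab; rewrite lee_wpmul2r// lee_fin.
  by exact/lefP/nd_nnsfun_approx.
Qed.

End Density.

Section MeasureComplements.
Context d (T : measurableType d) (R : realType).

Lemma measure_eq_off_null (mu : {measure set T -> \bar R}) (A B N : set T) :
  measurable A -> measurable B -> measurable N -> mu N = 0%E ->
  (forall w, ~ N w -> A w <-> B w) -> mu A = mu B.
Proof.
move=> mA mB mN N0 AB.
have le C D : measurable C -> measurable D -> (forall w, ~ N w -> C w -> D w) ->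
    (mu C <= mu D)%E.
  move=> mC mD CD; rewrite -[leRHS]adde0 -N0.
  apply: (@le_trans _ _ (mu (D `|` N))); last exact: measureU2.
  rewrite le_measure ?inE//; first exact: measurableU.
  by move=> w Cw; have [Nw|Nw] := pselect (N w); [right|left; exact: CD].
by apply/eqP; rewrite eq_le !le// => w /AB[].
Qed.

Lemma restricted_law d2 (T2 : measurableType d2) (Q : {measure set T -> \bar R})
    (S : set T) (Z : T -> T2) : measurable S -> measurable_fun setT Z ->
  exists N : {measure set T2 -> \bar R}, forall B, N B = Q (Z @^-1` B `&` S).
Proof. by move=> mS mZ; unshelve eexists (pushforward (mrestr Q mS) Z). Qed.

Lemma integral_restrict (P : {measure set T -> \bar R}) (D : set T)
    (f : T -> \bar R) :
  (\int[P]_(w in D) f w = \int[P]_w (f w * (\1_D w)%:E))%E.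
Proof.
rewrite integral_mkcond; apply: eq_integral => w _.
by rewrite epatch_indic.
Qed.

End MeasureComplements.

Section PathMeasures.
Context {R : realType} (k : time_kind) {E : pseudoPMetricType R}.

(** [exit_functional] applied to the sum of [N1] and [N2] gives an [f] equal to the time almost
    everywhere for both, which turns an event on pairs into an event on paths. *)
Lemma exit_concentrated_unique (U : set E)
    (N1 N2 : {measure set (pathT k E * \bar R)%type -> \bar R}) : open U ->
  (N1 setT < +oo)%E -> (N2 setT < +oo)%E ->
  exit_concentrated U N1 -> exit_concentrated U N2 ->
  (forall B : set (pathT k E), measurable B ->
    N1 [set z | B z.1] = N2 [set z | B z.1]) ->
  forall B, measurable B -> N1 B = N2 B.
Proof.
move=> oU fin1 fin2 conc1 conc2 N12 B mB.
have [N NE] : exists N : {measure set (pathT k E * \bar R)%type -> \bar R},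
    forall A, N A = (N1 A + N2 A)%E.
  by exists (measure_add N1 N2) => A; exact: measure_addE.
have [||f mf] := @exit_functional _ k _ _ oU N.
- by rewrite NE lte_add_pinfty.
- by move=> C mC hC; rewrite NE conc1// conc2// adde0.
have mne : measurable [set z : pathT k E * \bar R | f z.1 != z.2].
  rewrite -[X in measurable X]setTI; apply: measurable_neqe => //.
  exact: measurableT_comp.
rewrite NE => /eqP; rewrite padde_eq0// => /andP[/eqP n1 /eqP n2].
have mBf : measurable [set x : pathT k E | B (x, f x)].
  rewrite -[X in measurable X]setTI.
  by apply: (measurable_fun_pair (@measurable_id _ _ _) mf).
have mBf' : measurable [set z : pathT k E * \bar R | B (z.1, f z.1)].
  by rewrite -[X in measurable X]setTI; exact: (measurable_fst measurableT _ mBf).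
have fB (N' : {measure set (pathT k E * \bar R)%type -> \bar R}) :
    N' [set z | f z.1 != z.2] = 0%E -> N' B = N' [set z | B (z.1, f z.1)].
  move=> n0; apply: measure_eq_off_null n0 _ => // z /= /negP.
  by rewrite negbK => /eqP ->; case: z.
by rewrite (fB N1)// (fB N2)//; exact: N12 mBf.
Qed.

Definition cylinder (l : seq R) (B : R -> set (borel E)) : set (pathT k E) :=
  [set x | forall t, t \in l -> B t (x t)].

Lemma measurable_cylinder l B :
  (forall t, t \in l -> times k t /\ measurable (B t)) ->
  measurable (cylinder l B).
Proof. by move=> lB; apply: sub_sigma_algebra; left; exists l; exists B. Qed.

(** A property of the law alone: cylinders up to time [s] stand for the past. Total mass and initial
    law are left free, so that restrictions of probability measures qualify. *)
Definition path_markov (p : R -> R.-pker (borel E) ~> (borel E))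
    (M : {measure set (pathT k E) -> \bar R}) :=
  forall s t l B C, times k s -> times k t ->
    (forall u, u \in l -> [/\ times k u, u <= s & measurable (B u)]) ->
    measurable C ->
    M (cylinder l B `&` [set x | C (x (s + t))]) =
    (\int[M]_(x in cylinder l B) p t (x s) C)%E.

Lemma path_markov_integral p M s t l B C : path_markov p M ->
  times k s -> times k t ->
  (forall u, u \in l -> [/\ times k u, u <= s & measurable (B u)]) ->
  measurable C ->
  forall nu : {measure set (borel E) -> \bar R},
  (forall D, measurable D -> nu D = M (cylinder l B `&` [set x | D (x s)])) ->
  M (cylinder l B `&` [set x | C (x (s + t))]) = (\int[nu]_y p t y C)%E.
Proof.
move=> MM ts tt lB mC nu nuE; rewrite MM//.
have mcyl : measurable (cylinder l B).
  by apply: measurable_cylinder => u /lB[].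
rewrite (@ge0_integral_density _ _ _ _ _ M (fun x : pathT k E => x s : borel E)
  (fun x => (\1_(cylinder l B) x)%:E)) //.
- exact: integral_restrict.
- exact: measurable_coord.
- exact/measurable_EFinP.
- move=> D mD; rewrite integral_indic ?nuE//.
  by rewrite -[X in measurable X]setTI; exact: measurable_coord.
- exact: measurable_kernel.
Qed.


Section Uniqueness.
Variables (p : R -> R.-pker (borel E) ~> (borel E))
  (M1 M2 : {measure set (pathT k E) -> \bar R}).
Hypotheses (MM1 : path_markov p M1) (MM2 : path_markov p M2)
  (M0 : forall B, measurable B ->
    M1 [set x | B (x 0 : borel E)] = M2 [set x | B (x 0)]).

Let path_le_last (x u : R) l : path <=%R x l -> u \in x :: l -> u <= last x l.
Proof.
elim: l x u => [|y l ih] x u /=; first by rewrite inE => _ /eqP ->.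
move=> /andP[xy yl]; rewrite inE => /predU1P[->|]; last exact: ih.
exact: le_trans xy (ih _ _ yl (mem_head _ _)).
Qed.

(** Induction on the last time: by the Markov property, the measure of the longer cylinder depends
    only on the law of the position at the preceding time [s] within the shorter one. *)
Let sorted_cylinder_unique l : forall B, path <=%R 0 l ->
  (forall t, t \in l -> times k t) -> (forall t, measurable (B t)) ->
  M1 (cylinder (0 :: l) B) = M2 (cylinder (0 :: l) B).
Proof.
elim/last_ind: l => [|l v ih] B.
  move=> _ _ mB; have := M0 (mB 0); rewrite (_ : cylinder _ B = [set x | B 0 (x 0)]) //.
  apply/seteqP; split => x /=; first by apply; exact: mem_head.
  by move=> Bx u; rewrite inE => /eqP ->.
rewrite rcons_path => /andP[l0]; set s := last 0 l => sv tl mB.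
have {}tl u : u \in rcons (0 :: l) v -> times k u.
  by rewrite rcons_cons inE => /predU1P[->|/tl //]; exact: times0.
have sl : s \in 0 :: l by exact: mem_last.
have ts : times k s by apply: tl; rewrite mem_rcons inE sl orbT.
have tv : times k v by apply: tl; rewrite mem_rcons mem_head.
have lB u : u \in 0 :: l -> [/\ times k u, u <= s & measurable (B u)].
  move=> ul; split => //; first by apply: tl; rewrite mem_rcons inE ul orbT.
  exact: path_le_last l0 ul.
have mcyl : measurable (cylinder (0 :: l) B).
  by apply: measurable_cylinder => u /lB[].
have -> : cylinder (0 :: rcons l v) B =
    cylinder (0 :: l) B `&` [set x | B v (x (s + (v - s)))].
  rewrite addrC subrK; apply/seteqP; split => x /=.
    move=> h; split => [u ul|]; apply: h; rewrite -rcons_cons mem_rcons ?mem_head//.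
    by rewrite inE ul orbT.
  by move=> [h hv] u; rewrite -rcons_cons mem_rcons inE => /predU1P[->//|]; exact: h.
have tvs : times k (v - s) by exact: timesB.
have [nu nuE] := restricted_law M1 mcyl (measurable_coord ts).
have nuE1 D : measurable D ->
    nu D = M1 (cylinder (0 :: l) B `&` [set x | D (x s)]).
  by move=> _; rewrite nuE setIC.
have nuE2 D : measurable D ->
    nu D = M2 (cylinder (0 :: l) B `&` [set x | D (x s)]).
  move=> mD; rewrite nuE1//.
  (* The condition at [s] is absorbed into the constraint already imposed there, which is why [B]
     must vary in the induction. *)
  have -> : cylinder (0 :: l) B `&` [set x | D (x s)] =
      cylinder (0 :: l) (fun u => if u == s then B u `&` D else B u).
    apply/seteqP; split => x /=.
      move=> [h Ds] u ul; case: eqP => [us|_]; last exact: h.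
      by split; [exact: h|rewrite us].
    move=> h; split => [u ul|]; last by have := h s sl; rewrite eqxx => -[].
    by have := h u ul; case: eqP => // _ [].
  apply: ih => // u.
    by move=> ul; apply: tl; rewrite mem_rcons !inE ul !orbT.
  by case: eqP => // _; exact: measurableI.
rewrite (path_markov_integral MM1 ts tvs lB (mB v) nuE1).
by rewrite (path_markov_integral MM2 ts tvs lB (mB v) nuE2).
Qed.

Lemma path_markov_unique : (M1 setT < +oo)%E ->
  (forall A : set (pathT k E), (forall x, rc_path k x -> ~ A x) ->
     M1 A = 0%E /\ M2 A = 0%E) ->
  forall A, measurable A -> M1 A = M2 A.
Proof.
move=> fin1 M12; apply: (@measure_unique _ R (pathT k E) (path_generators k) (fun=> setT)) => //.
- exact: path_generators_setI.
- by move=> _; left; exists [::]; exists (fun=> setT) => //; apply/seteqP.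
- by apply/seteqP; split => // x _; exists 0%N.
move=> A [[l [B lB ->]]|nA]; last by have [-> ->] := M12 _ nA.
(* Unlisted times receive the full space, so that 0 can be put in front without changing the set. *)
pose B' t := if t \in l then B t else setT.
have -> : [set x : R -> borel E | forall t, t \in l -> B t (x t)] =
    cylinder (0 :: sort <=%R l) B'.
  apply/seteqP; split => x /= h t; rewrite /B'.
    by case: ifPn => // tl _; exact: h.
  by move=> tl; have := h t; rewrite /B' inE mem_sort tl orbT; apply.
apply: sorted_cylinder_unique.
- rewrite path_min_sorted ?sort_le_sorted//.
  by apply/allP => t; rewrite mem_sort => /lB[/times_ge0].
- by move=> t; rewrite mem_sort => /lB[].
- by move=> t; rewrite /B'; case: ifPn => [/lB[]|_].
Qed.

End Uniqueness.
End PathMeasures.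

(** * Evaluation at random times *)

Section Evaluation.
Context {R : realType} (k : time_kind) {E : pseudoPMetricType R}.

(** For open [V], the value at [g w] lies in [V] exactly when, for some [n] and [N], the values at
    all [q j] in the window of length 1 / (N + 1) from [g w] lie in [W n], that is, well inside [V].
    Right-continuity gives both directions. *)
Lemma measurable_fun_eval d (T : measurableType d) (D : set T)
    (Y : R -> T -> borel E) (g : T -> R) : measurable D ->
  (forall w, D w -> rc_path k (Y ^~ w)) ->
  (forall t, times k t -> measurable_fun D (Y t)) ->
  measurable_fun D g -> (forall w, D w -> times k (g w)) ->
  measurable_fun D (fun w => Y (g w) w).
Proof.
move=> mD rY mY mg tg; apply: (@measurability _ _ T (borel E) D _ (@open E)) => // _ [V oV <-].
have [q [tq dq]] := @countable_dense_times R k.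
pose W n : set E := [set x | ball x n.+1%:R^-1 `<=` V]^°.
pose I N j : set R := [set y | y <= q j < y + N.+1%:R^-1].
pose S n N j := (D `\` (D `&` g @^-1` I N j)) `|` (D `&` Y (q j) @^-1` W n).
have mI N j : measurable (I N j).
  rewrite (_ : I N j = `]q j - N.+1%:R^-1, q j]%classic).
    exact: measurable_itv.
  by apply/seteqP; split => y /=; rewrite in_itv/= ltrBlDr andbC.
have mS n N j : measurable (S n N j).
  apply: measurableU; first by apply: measurableD => //; exact: mg.
  by apply: mY => //; apply: measurable_open; exact: open_interior.
suff -> : D `&` (fun w => Y (g w) w) @^-1` V =
    \bigcup_n \bigcup_N \bigcap_j S n N j.
  apply: bigcupT_measurable => n; apply: bigcupT_measurable => N.
  exact: bigcapT_measurable.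
have near0 (e : R) : 0 < e -> exists n : nat, n.+1%:R^-1 < e.
  move=> e0; have [n _ hn] : \forall n \near \oo, n.+1%:R^-1 < e.
    exact: near_infty_natSinv_lt (PosNum e0).
  by exists n; exact: (hn n (leqnn n)).
apply/seteqP; split => w.
  move=> [Dw /= Vw]; have : nbhs (Y (g w) w) V by exact: open_nbhs_nbhs.
  rewrite nbhs_ballP => -[e /= e0 eV].
  have e20 : 0 < e / 2 by rewrite divr_gt0.
  have [n ne] := near0 _ e20.
  have Wy : nbhs (Y (g w) w) (W n).
    rewrite /W; apply: nbhs_interior; rewrite nbhs_ballP; exists (e / 2).
      by rewrite /= divr_gt0.
    move=> y ye z yz; apply: eV; rewrite [e]splitr.
    by apply: ball_triangle ye _; apply: le_ball yz; exact: ltW.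
  have [e' e'0 he'] := rY w Dw _ (tg w Dw) _ Wy.
  have [N Ne] := near0 _ e'0.
  exists n => //; exists N => // j _.
  have [Ij|Ij] := pselect (I N j (g w)); [right|left].
    split => //=; apply: he' => //; move: Ij => /andP[-> /lt_le_trans]; apply.
    by rewrite lerD2l ltW.
  by split => // -[].
move=> [n _ [N _ hS]].
have Dw : D w by have [[]|[]] := hS 0%N Logic.I.
split => //=.
have Vn : nbhs (Y (g w) w) (ball (Y (g w) w) n.+1%:R^-1).
  by apply: nbhsx_ballx; rewrite invr_gt0.
have [e' e'0 he'] := rY w Dw _ (tg w Dw) _ Vn.
have m0 : 0 < Num.min N.+1%:R^-1 e' by rewrite lt_min e'0 invr_gt0 ltr0n.
have [j /andP[gj]] := dq _ (tg w Dw) _ m0.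
rewrite -ltrBlDl lt_min !ltrBlDl => /andP[jN je'].
have [[_ []]|[_ /interior_subset]] := hS j Logic.I; first by split => //=; rewrite /I/= gj.
by apply; apply: ball_sym; apply: he' => //; rewrite gj.
Qed.

End Evaluation.

Arguments cylinder {R} k {E} l B.

Section PathLaws.
Context {R : realType} (k : time_kind) {E : pseudoPMetricType R}.
Context d (T : measurableType d) (Q : {measure set T -> \bar R}) (S : set T)
  (Y : R -> T -> borel E) (p : R -> R.-pker (borel E) ~> (borel E)).
Hypotheses (mS : measurable S) (rY : forall w, rc_path k (Y ^~ w))
  (mY : forall t, times k t -> measurable_fun setT (Y t)).

Lemma path_markov_law (M : {measure set (pathT k E) -> \bar R}) :
  (forall B, measurable B -> M B = Q ([set w | B (Y ^~ w)] `&` S)) ->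
  (forall s t l B C, times k s -> times k t ->
    (forall u, u \in l -> [/\ times k u, u <= s & measurable (B u)]) ->
    measurable C ->
    Q ([set w | cylinder k l B (Y ^~ w) /\ C (Y (s + t) w)] `&` S) =
    (\int[Q]_(w in [set w | cylinder k l B (Y ^~ w)] `&` S) p t (Y s w) C)%E) ->
  path_markov p M.
Proof.
move=> ME QM s t l B C ts tt lB mC.
have mcyl : measurable (cylinder k l B).
  by apply: measurable_cylinder => u /lB[].
have mtC : measurable [set x : pathT k E | C (x (s + t))].
  by rewrite -[X in measurable X]setTI; exact: (measurable_coord (timesD ts tt)).
rewrite ME ?[LHS](QM s t l B C)//; last exact: measurableI.
have mYp := measurable_path rY mY.
rewrite [RHS]integral_restrict (@ge0_integral_density _ _ _ _ _ Q
  (fun w => Y ^~ w : pathT k E) (fun w => (\1_S w)%:E))//.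
- rewrite integral_restrict; apply: eq_integral => w _ /=.
  by rewrite indicI/= EFinM muleA.
- exact/measurable_EFinP.
- by move=> D mD; rewrite integral_indic ?ME 1?setIC// -[X in measurable X]setTI; exact: mYp.
- apply: emeasurable_funM; last exact/measurable_EFinP.
  exact: measurableT_comp (measurable_kernel _ _ _) (measurable_coord ts).
Qed.

End PathLaws.

(** * Regeneration under a restricted measure *)

Section Regeneration.
Context {R : realType} (k : time_kind) {E : pseudoPMetricType R}.

Lemma path_markov_mscale (p : R -> R.-pker (borel E) ~> (borel E))
    (M : {measure set (pathT k E) -> \bar R}) (c : {nonneg R}) :
  path_markov p M -> path_markov p (mscale c M).
Proof.
move=> MM s t l B C ts tt lB mC.
have mcyl : measurable (cylinder k l B).
  by apply: measurable_cylinder => u /lB[].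
rewrite ge0_integral_mscale//; first by rewrite /= /mscale -MM.
apply: measurable_funTS.
exact: measurableT_comp (measurable_kernel _ _ _) (measurable_coord ts).
Qed.

Context d (Omega : measurableType d)
  (F : R -> set (set Omega)) (X : R -> Omega -> borel E)
  (P : probability (borel E) R -> probability Omega R)
  (p : R -> R.-pker (borel E) ~> (borel E)) (U : set E).
Hypotheses (markovX : strong_markov k F X P p) (oU : open U)
  (mT : measurable_fun setT (exit_time k U X)).

Lemma rc_path_markov w : rc_path k (X ^~ w).
Proof. exact: cadlag_rc_path (sm_cadlag markovX w). Qed.

Lemma filtration_sub t A : times k t -> F t A -> measurable A.
Proof. by move=> tt; have [_ FM _] := sm_filtration markovX; exact: FM. Qed.

Lemma filtration_measurable s t (B : set (borel E)) : times k s -> times k t ->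
  s <= t -> measurable B -> F t (X s @^-1` B).
Proof.
move=> ts tt st mB; have [_ _ FF] := sm_filtration markovX.
exact: FF ts tt st _ (sm_adapted markovX ts mB).
Qed.

Lemma measurable_process t : times k t -> measurable_fun setT (X t).
Proof.
move=> tt _ B mB; rewrite setTI; apply: (filtration_sub tt).
exact: (sm_adapted markovX tt mB).
Qed.

Lemma filtration_setI t : times k t -> setI_closed (F t).
Proof.
move=> tt; have [/(_ t tt) sF _ _] := sm_filtration markovX.
by have [|_ _ _] := (sigma_algebraP (U := setT) (C := F t) _).1 sF; first by [].
Qed.

Lemma filtration_cylinder (l : seq R) (B : R -> set (borel E)) (s r : R) :
  times k s -> times k r ->
  (forall u, u \in l -> [/\ times k u, u <= s & measurable (B u)]) ->
  F (r + s) [set w | cylinder k l B (fun u => X (r + u) w)].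
Proof.
move=> ts tr lB; have trs := timesD tr ts.
elim: l lB => [|v l ih] lB.
  rewrite (_ : [set w | _] = setT `\` set0).
    have [/(_ _ trs) [F0 FC _] _ _] := sm_filtration markovX.
    exact: FC.
  by apply/seteqP; split => w //= _; split.
rewrite (_ : [set w | _] = X (r + v) @^-1` B v `&`
    [set w | cylinder k l B (fun u => X (r + u) w)]).
  have [tv vs mB] := lB v (mem_head _ _).
  apply: filtration_setI => //; last by apply: ih => u ul; apply: lB; rewrite inE ul orbT.
  by apply: filtration_measurable => //; [exact: timesD|rewrite lerD2l].
apply/seteqP; split => w /=.
  move=> h; split; first by apply: h; exact: mem_head.
  by move=> u ul; apply: h; rewrite inE ul orbT.
by move=> [h hl] u; rewrite inE => /predU1P[->//|]; exact: hl.
Qed.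

(** Here the restricting event must belong to [F r]: intersected with the shifted cylinder, it is
    part of the past at time [r + s]. *)
Lemma shifted_markov (mu : probability (borel E) R) r A s t l B C :
  times k r -> F r A -> times k s -> times k t ->
  (forall u, u \in l -> [/\ times k u, u <= s & measurable (B u)]) ->
  measurable C ->
  P mu ([set w | cylinder k l B (fun u => X (r + u) w) /\ C (X (r + (s + t)) w)]
        `&` A) =
  (\int[P mu]_(w in [set w | cylinder k l B (fun u => X (r + u) w)] `&` A)
     p t (X (r + s) w) C)%E.
Proof.
move=> tr FA ts tt lB mC; have trs := timesD tr ts.
rewrite -(sm_markov markovX mu trs tt)//; last first.
  apply: filtration_setI => //; first exact: filtration_cylinder.
  have [_ _ FF] := sm_filtration markovX.
  by apply: FF FA => //; rewrite lerDl; exact: times_ge0 ts.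
congr (P mu _); apply/seteqP; split => w /=; rewrite addrA.
  by move=> [[]].
by move=> [[]].
Qed.

(* Under the restriction of [Q] to [S], the path [Y] is Markov with kernel [p]. As
   only the law matters, [S] may be changed on a null set. *)
Definition regenerates d' (Omega' : measurableType d')
    (Q : {measure set Omega' -> \bar R}) (S : set Omega')
    (Y : R -> Omega' -> borel E) : Prop :=
  forall M : {measure set (pathT k E) -> \bar R},
    (forall B, measurable B -> M B = Q ([set w | B (Y ^~ w)] `&` S)) ->
    path_markov p M.

(** Both path laws are Markov with the same kernel and, up to the factor [Q S], the same initial
    law, so they agree; concentration on the graph of the exit time then brings in the time. *)
Lemma regenerates_law d' (Omega' : measurableType d')
    (Q : {measure set Omega' -> \bar R}) (S : set Omega')
    (Y : R -> Omega' -> borel E) (T : Omega' -> \bar R)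
    (mu : probability (borel E) R) :
  (Q setT < +oo)%E -> measurable S ->
  (forall w, rc_path k (Y ^~ w)) ->
  (forall t, times k t -> measurable_fun setT (Y t)) ->
  measurable_fun setT T ->
  regenerates Q S Y ->
  (forall B : set (borel E), measurable B ->
    Q (Y 0 @^-1` B `&` S) = (Q S * mu B)%E) ->
  exit_concentrated (k := k) U (fun B => Q ([set w | B (Y ^~ w, T w)] `&` S)) ->
  forall B : set (pathT k E * \bar R), measurable B ->
    Q ([set w | B (Y ^~ w, T w)] `&` S) =
    (Q S * P mu [set w | B (X ^~ w, exit_time k U X w)])%E.
Proof.
move=> Qfin mS rY mY mT' QM Q0 Qconc B mB.
have mXp := measurable_path rc_path_markov measurable_process.
have mYp := measurable_path rY mY.
have mXT := measurable_fun_pair mXp mT.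
have mYT := measurable_fun_pair mYp mT'.
have [N1 N1E] := restricted_law Q mS mYT.
have [N2 N2E] := restricted_law (P mu) measurableT mXT.
have [M1 M1E] := restricted_law Q mS mYp.
have [M2 M2E] := restricted_law (P mu) measurableT mXp.
have QSfin : Q S \is a fin_num.
  by rewrite ge0_fin_numE// (le_lt_trans _ Qfin)// le_measure ?inE.
have c0 : 0 <= fine (Q S) by exact: fine_ge0.
pose c := NngNum c0.
have cE : Q S = (c%:num)%:E by rewrite /= fineK.
have N2T : N2 setT = 1%E.
  by rewrite N2E setIT preimage_setT; exact: probability_setT.
suff -> : Q ([set w | B (Y ^~ w, T w)] `&` S) = mscale c N2 B.
  by rewrite /mscale N2E setIT cE.
rewrite -[LHS]N1E; apply: (exit_concentrated_unique oU (N1 := N1)) => //.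
- by rewrite N1E preimage_setT setTI -ge0_fin_numE.
- by rewrite /= /mscale N2T mule1 ltry.
- by move=> C mC hC; rewrite N1E; exact: Qconc.
- move=> C mC hC; rewrite /= /mscale N2E setIT (_ : _ @^-1` _ = set0) ?measure0 ?mule0//.
  by apply/seteqP; split => w //= /hC; apply; exact: rc_path_markov.
move=> C mC; transitivity (M1 C); first by rewrite N1E M1E.
transitivity (mscale c M2 C); last by rewrite /= /mscale N2E M2E.
apply: (path_markov_unique (p := p)) => //.
- by apply: QM => D _; rewrite M1E.
- apply: path_markov_mscale; apply: (path_markov_law (Q := P mu) (S := setT) (Y := X)) => //.
  + exact: rc_path_markov.
  + exact: measurable_process.
  + move=> s t l D A ts tt lD mA.
    have FT : F 0 setT.
      have [/(_ _ (times0 k))[F0 FC _] _ _] := sm_filtration markovX.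
      by rewrite -(setD0 setT); exact: FC.
    have XE : X = (fun u => X (0 + u)) by apply/funext => u; rewrite add0r.
    by rewrite XE; exact: (shifted_markov mu (times0 k)).
- move=> A mA; rewrite M1E [LHS]Q0//= /mscale M2E setIT cE.
  by congr (_ * _)%E; exact: (esym (sm_initial markovX mu mA)).
- by rewrite M1E preimage_setT setTI -ge0_fin_numE.
- move=> A nA; split.
    rewrite M1E (_ : _ @^-1` _ = set0) ?set0I ?measure0//.
    by apply/seteqP; split => w //= /nA; apply.
  rewrite /= /mscale M2E (_ : _ @^-1` _ = set0) ?set0I ?measure0 ?mule0//.
  by apply/seteqP; split => w //= /nA; apply; exact: rc_path_markov.
Qed.

End Regeneration.

(** * Starting afresh from the quasistationary distribution *)

Section Restart.
Context {R : realType} (k : time_kind) {E : pseudoPMetricType R}.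
Context d (Omega : measurableType d)
  (F : R -> set (set Omega)) (X : R -> Omega -> borel E)
  (P : probability (borel E) R -> probability Omega R)
  (p : R -> R.-pker (borel E) ~> (borel E)) (U : set E).
Hypotheses (markovX : strong_markov k F X P p) (oU : open U)
  (mT : measurable_fun setT (exit_time k U X)).
Variable mu : probability (borel E) R.

Let rX := rc_path_markov markovX.

Let measurable_gt (r : R) : measurable [set w | (r%:E < exit_time k U X w)%E].
Proof. by rewrite -[X in measurable X]setTI; exact: emeasurable_fun_o_infty. Qed.

(* The survival event need not belong to the filtration, being an uncountable
   intersection; it does up to a null set. *)
Lemma survival_filtration r : times k r -> exists A N : set Omega,
  [/\ F r A, measurable N, P mu N = 0%E &
      forall w, ~ N w -> A w <-> (r%:E < exit_time k U X w)%E].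
Proof.
(* The stopped path [Y] is determined within [F r], and [T] exceeds [r] exactly on survival; a
   function of [Y] almost surely equal to [T] therefore decides survival. *)
move=> tr; pose Y s w := X (Num.min s r) w.
pose T w := if (exit_time k U X w <= r%:E)%E then exit_time k U X w else +oo%E.
have rY w : rc_path k (Y ^~ w) by exact: (rc_path_stop tr (@rX w)).
have FY t : times k t -> forall B, measurable B -> F r (Y t @^-1` B).
  move=> tt B mB; apply: (filtration_measurable markovX) => //; first exact: times_min.
  by rewrite ge_min lexx orbT.
have mY t : times k t -> measurable_fun setT (Y t).
  by move=> tt; apply: (measurable_process markovX); exact: times_min.
have mT' : measurable_fun setT T.
  apply: measurable_fun_ifT => //; apply: (measurable_fun_bool true).
  exact: emeasurable_fun_infty_c.
have mYp := measurable_path rY mY.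
have [N NE] := restricted_law (P mu) measurableT (measurable_fun_pair mYp mT').
have TE w : T w = path_exit k U (Y ^~ w) by rewrite [RHS](path_exit_stop oU (@rX w) tr).
have [||f mf Nf] := exit_functional oU (N := N).
- by rewrite NE setIT preimage_setT; apply: le_lt_trans (ltry 1); exact: probability_le1.
- move=> B mB hB; rewrite NE setIT (_ : _ @^-1` _ = set0) ?measure0//.
  by apply/seteqP; split => w //=; rewrite TE; exact: hB.
exists [set w | (r%:E < f (Y ^~ w))%E].
exists [set w | f (Y ^~ w) != T w]; split.
- have [/(_ r tr) sF _ _] := sm_filtration markovX.
  apply: (path_preimage sF rY FY (B := [set x | (r%:E < f x)%E])).
  by rewrite -[X in measurable X]setTI; exact: emeasurable_fun_o_infty.
- rewrite -[X in measurable X]setTI; apply: measurable_neqe => //.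
  exact: measurableT_comp mf mYp.
- by have := Nf; rewrite NE setIT.
- move=> w /negP; rewrite negbK => /eqP /= ->; rewrite /T.
  case: (leP (exit_time k U X w) r%:E) => Tr.
    by split => // /lt_le_trans/(_ Tr); rewrite ltxx.
  by split => // _; exact: ltry.
Qed.

(** The hypothesis is the product form of quasistationarity at the single time [r]. Survival is
    exchanged for an event of [F r] to make the shifted path Markov. *)
Lemma restart r : times k r ->
  (forall B : set (borel E), measurable B ->
    P mu (X r @^-1` B `&` [set w | (r%:E < exit_time k U X w)%E]) =
    (P mu [set w | (r%:E < exit_time k U X w)%E] * mu B)%E) ->
  forall B : set (pathT k E * \bar R), measurable B ->
    P mu ([set w | B (fun s => X (r + s) w, (exit_time k U X w - r%:E)%E)]
          `&` [set w | (r%:E < exit_time k U X w)%E]) =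
    (P mu [set w | (r%:E < exit_time k U X w)%E] *
     P mu [set w | B (X ^~ w, exit_time k U X w)])%E.
Proof.
move=> tr X0 B mB; set S := [set w | (r%:E < _)%E].
have mS : measurable S by exact: measurable_gt.
have mXr t : times k t -> measurable_fun setT (X (r + t)).
  by move=> tt; apply: (measurable_process markovX); exact: timesD.
apply: (regenerates_law markovX oU mT (Q := P mu) (Y := fun s => X (r + s))) => //.
- by apply: le_lt_trans (ltry 1); exact: probability_le1.
- by move=> w; exact: (rc_path_shift tr (@rX w)).
- by apply: emeasurable_funB => //; exact: measurable_cst.
- move=> M ME; have [A [N [FA mN N0 AS]]] := survival_filtration tr.
  have mA := filtration_sub markovX tr FA.
  have rXr w : rc_path k (fun s => X (r + s) w) by exact: (rc_path_shift tr (@rX w)).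
  apply: (path_markov_law (Q := P mu) (S := A) (Y := fun s => X (r + s))) => //.
  + move=> C mC; rewrite ME//; apply: (measure_eq_off_null _ _ mN N0).
    * apply: measurableI => //; rewrite -[X in measurable X]setTI.
      exact: (measurable_path rXr mXr).
    * apply: measurableI => //; rewrite -[X in measurable X]setTI.
      exact: (measurable_path rXr mXr).
    * by move=> w /AS[AS1 AS2]; split => -[? ?]; split => //; [exact: AS2|exact: AS1].
  + by move=> s t l C D ts tt lC mD; exact: (shifted_markov markovX).
- by move=> C mC; rewrite addr0; exact: X0.
- move=> C mC hC; rewrite (_ : _ `&` _ = set0) ?measure0//.
  apply/seteqP; split => w //= [Cw Sw].
  have e : (exit_time k U X w - r%:E)%E = path_exit k U (fun s => X (r + s) w).
    exact: (esym (path_exit_shift oU (@rX w) tr Sw)).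
  by move: Cw; rewrite e; exact: (hC _ (rc_path_shift tr (@rX w))).
Qed.

End Restart.

(** * Weights depending on the starting point *)

Section Reweighting.
Context {R : realType} (k : time_kind) {E : pseudoPMetricType R}.
Local Open Scope ereal_scope.

(** Such a weight belongs to the past at every time. Formally, the Markov equation with an extra
    constraint on [x 0] identifies the law of [x 0] on the event, and [g] is integrated against that
    law. *)
Lemma path_markov_reweight (p : R -> R.-pker (borel E) ~> (borel E))
    (M N : {measure set (pathT k E) -> \bar R}) (g : borel E -> \bar R) :
  path_markov p M -> measurable_fun setT g -> (forall y, 0 <= g y) ->
  (forall y, g y \is a fin_num) ->
  (forall B, measurable B -> N B = \int[M]_(x in B) g (x 0%R)) ->
  path_markov p N.
Proof.
move=> MM mg g0 gfin NE s t l B C ts tt lB mC.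
have mcyl : measurable (cylinder k l B) by apply: measurable_cylinder => u /lB[].
have m0 := measurable_coord (E := E) (times0 k).
have mst : measurable [set x : pathT k E | C (x (s + t)%R)].
  by rewrite -[X in measurable X]setTI; exact: (measurable_coord (timesD ts tt)).
have mpt : measurable_fun setT (fun x : pathT k E => p t (x s) C).
  exact: measurableT_comp (measurable_kernel _ _ _) (measurable_coord ts).
have pfin y : p t y C \is a fin_num.
  rewrite ge0_fin_numE// (@le_lt_trans _ _ (p t y setT))//.
    by rewrite le_measure ?inE.
  by rewrite prob_kernel ltry.
have mind A : measurable A ->
    measurable_fun setT (fun x : pathT k E => (\1_A x)%:E : \bar R).
  by move=> mA; exact/measurable_EFinP.
set A := cylinder k l B `&` [set x | C (x (s + t)%R)].
have mA : measurable A by exact: measurableI.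
have [nu nuE] := restricted_law M mA m0.
rewrite NE//.
transitivity (\int[nu]_y g y).
  rewrite [LHS]integral_restrict.
  rewrite (@ge0_integral_density _ _ _ _ _ M (fun x : pathT k E => x 0%R : borel E)
    (fun x => (\1_A x)%:E))//; first exact: mind.
  move=> D mD; rewrite integral_indic ?nuE 1?setIC//.
  by rewrite -[X in measurable X]setTI; exact: m0.
transitivity (\int[M]_x (g (x 0%R) * (p t (x s) C * (\1_(cylinder k l B) x)%:E))).
  apply: (@ge0_integral_density _ _ _ _ _ M (fun x : pathT k E => x 0%R : borel E)
    (fun x => p t (x s) C * (\1_(cylinder k l B) x)%:E))%E => //.
  - by apply: emeasurable_funM => //; exact: mind.
  - by move=> x; rewrite fin_numM// pfin.
  move=> D mD; rewrite nuE.
  (* [D] joins the constraint at time 0, which [l] may or may not list already. *)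
  pose B' u := (if u == 0%R then D `&` (if u \in l then B u else setT) else B u).
  have lB' u : u \in 0%R :: l -> [/\ times k u, (u <= s)%R & measurable (B' u)].
    rewrite inE /B'; case: eqP => [->|_] /= ul; last exact: lB.
    split; [exact: times0|exact: times_ge0 ts|apply: measurableI => //].
    by case: ifPn => // /lB[].
  have cylE : (fun x : pathT k E => x 0%R : borel E) @^-1` D `&` cylinder k l B =
      cylinder k (0%R :: l) B'.
    apply/seteqP; split => x /=.
      move=> [Dx h] u; rewrite inE /B'; case: eqP => [->|_] /= ul; last exact: h.
      by split => //; case: ifPn => // /h.
    move=> h; split; first by have := h 0%R (mem_head _ _); rewrite /B' eqxx => -[].
    move=> u ul; have := h u; rewrite inE ul orbT => /(_ isT); rewrite /B'.
    by case: eqP => [_ /= [_]|//]; rewrite ul.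
  rewrite /A setIA cylE (MM s t _ _ _ ts tt lB')// -cylE.
  rewrite [LHS]integral_restrict [RHS]integral_restrict.
  by apply: eq_integral => x _; rewrite indicI EFinM muleA muleAC.
rewrite [RHS]integral_restrict.
rewrite (@ge0_integral_density _ _ _ _ _ M id (fun x => g (x 0%R)))//.
- by apply: eq_integral => x _; rewrite muleC.
- exact: measurableT_comp.
- by apply: emeasurable_funM => //; exact: mind.
Qed.

End Reweighting.

(** * Copies of the process *)

Section Copies.
Context {R : realType} (k : time_kind) {E : pseudoPMetricType R}.

Let path_time_generators : set (set ((R -> borel E) * \bar R)) :=
  [set A | (exists2 t, times k t & exists2 B : set (borel E),
              measurable B & A = [set x | B (x.1 t)]) \/
           (exists2 B : set (\bar R), measurable B & A = [set x | B x.2])].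

(** The path space has additional measurable sets, those without right-continuous paths, on which
    the law of a copy is not given; on right-continuous paths they make no difference. *)
Lemma measurable_path_time (B : set (pathT k E * \bar R)) : measurable B ->
  exists2 B', path_time_sigma k B' &
    forall x s, rc_path k x -> B (x, s) <-> B' (x, s).
Proof.
move=> mB.
pose V := g_sigma_algebraType path_time_generators.
(* Other paths are replaced by a constant one: every path in the image of [f] is right-continuous,
   and measurability reduces to coordinates. *)
pose f (z : (R -> borel E) * \bar R) : V :=
  if `[< rc_path k z.1 >] then z else ((fun=> point), z.2).
pose T := g_sigma_algebra_preimageType f.
have mV (A : set V) : measurable A -> measurable (f @^-1` A : set T).
  by move=> mA; exists A => //; rewrite setTI.
have mf1 : measurable_fun setT (fun z : T => (f z).1 : pathT k E).
  apply: (@measurable_path _ k E _ T (fun t z => (f z).1 t)) => [z t tt W Wt|t tt].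
    move: Wt; rewrite /f; case: ifPn => [/asboolP rz|_] Wt; first exact: rz tt W Wt.
    by exists 1 => // u _ _; exact: nbhs_singleton Wt.
  move=> _ C mC; rewrite setTI.
  apply: (mV [set z | C (z.1 t)]); apply: sub_sigma_algebra.
  by left; exists t => //; exists C.
have mf2 : measurable_fun setT (fun z : T => (f z).2).
  move=> _ C mC; rewrite setTI.
  by apply: (mV [set z | C z.2]); apply: sub_sigma_algebra; right; exists C.
have := measurable_fun_pair mf1 mf2 measurableT mB.
rewrite setTI => -[B' mB' BB']; exists B' => // x s rx.
have fE : f (x, s) = (x, s) by rewrite /f asboolT.
have : (f @^-1` B') (x, s) <-> B ((f (x, s)).1, (f (x, s)).2).
  by rewrite -[f @^-1` B']setTI BB'.
by rewrite /preimage /= fE => -[? ?]; split.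
Qed.

Lemma sigma_of_sub d (T : measurableType d) d' (T' : measurableType d')
    (J : Type) (D : set J) (Y : J -> T -> T') :
  (forall j, D j -> measurable_fun setT (Y j)) ->
  sigma_of D Y `<=` measurable.
Proof.
move=> mY; apply: smallest_sub; first exact: sigma_algebra_measurable.
by move=> A [j Dj [B mB <-]]; exact: mY.
Qed.

Lemma sigma_of_preimage d (T : measurableType d) d' (T' : measurableType d')
    (J : Type) (D : set J) (Y : J -> T -> T') j B :
  D j -> measurable B -> sigma_of D Y (Y j @^-1` B).
Proof.
move=> Dj mB; apply: sub_sigma_algebra; exists j => //.
by exists B => //; rewrite setTI.
Qed.

Context d (Omega : measurableType d)
  (F : R -> set (set Omega)) (X : R -> Omega -> borel E)
  (P : probability (borel E) R -> probability Omega R)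
  (p : R -> R.-pker (borel E) ~> (borel E)) (U : set E).
Hypothesis markovX : strong_markov k F X P p.
Context d' (Omega' : measurableType d') (P' : probability Omega' R)
  (Y : R -> Omega' -> borel E) (T : Omega' -> \bar R).
Hypothesis copyY : is_copy k X P U P' Y T.

Lemma rc_path_copy w : rc_path k (Y ^~ w).
Proof. by have [cY _ _ _ _] := copyY; exact: cadlag_rc_path. Qed.

Lemma measurable_copy t : times k t -> measurable_fun setT (Y t).
Proof. by have [_ mY _ _ _] := copyY; exact: mY. Qed.

Lemma measurable_copy_time : measurable_fun setT T.
Proof. by have [_ _ _ mS _] := copyY. Qed.

Lemma copy_law : exists mu, forall B : set (pathT k E * \bar R), measurable B ->
  P' [set w | B (Y ^~ w, T w)] = P mu [set w | B (X ^~ w, exit_time k U X w)].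
Proof.
have [_ _ _ _ [mu lawY]] := copyY; exists mu => B mB.
have [B' mB' BB'] := measurable_path_time mB.
have := lawY _ mB'; congr (_ = _); congr (_ _); apply/seteqP; split => w /=.
- by move/BB'; apply; exact: rc_path_copy.
- by move=> ?; apply/BB' => //; exact: rc_path_copy.
- by move/BB'; apply; exact: (rc_path_markov markovX).
- by move=> ?; apply/BB' => //; exact: (rc_path_markov markovX).
Qed.

(** [T] is not defined as the exit time of [Y]; the pair only has the law of a path with its exit
    time, for which a set missing the graph has empty preimage. *)
Lemma copy_concentrated S : measurable S ->
  exit_concentrated (k := k) U (fun B => P' ([set w | B (Y ^~ w, T w)] `&` S)).
Proof.
move=> mS B mB hB; have [mu lawY] := copy_law.
have mBY : measurable [set w | B (Y ^~ w, T w)].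
  rewrite -[X in measurable X]setTI.
  apply: (measurable_fun_pair _ measurable_copy_time) mB => //.
  exact: (measurable_path rc_path_copy measurable_copy).
apply: (@subset_measure0 _ _ _ P' _ [set w | B (Y ^~ w, T w)]) => //.
  exact: measurableI.
rewrite [LHS]lawY// (_ : [set w | _] = set0) ?measure0//.
by apply/seteqP; split => w //=; apply: hB; exact: (rc_path_markov markovX).
Qed.

(** With [g] a version of the conditional probability of [S] given [Y 0], the path law on [S] has
    density [g (x 0)] with respect to the full path law. *)
Lemma copy_regenerates S :
  (forall A, sigma_of (times k) Y A -> exists f g : borel E -> R,
    [/\ cond_prob_version P' (Y 0) A f, cond_prob_version P' (Y 0) S g &
        cond_prob_version P' (Y 0) (A `&` S) (f \* g)]) ->
  measurable S -> regenerates k p (P' : {measure set Omega' -> \bar R}) S Y.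
Proof.
move=> indep mS N NE.
have mYp := measurable_path rc_path_copy measurable_copy.
have m0 := measurable_copy (times0 k).
have [mu lawY] := copy_law.
have mXp := measurable_path (rc_path_markov markovX) (measurable_process markovX).
have [M ME] := restricted_law (P' : {measure set Omega' -> \bar R}) measurableT mYp.
have MM : path_markov p M.
  apply: (path_markov_law (Q := P mu) (S := setT) (Y := X)) => //.
  - exact: (rc_path_markov markovX).
  - exact: (measurable_process markovX).
  - move=> B mB; rewrite ME !setIT.
    apply: (lawY [set z | B z.1]).
    by rewrite -[X in measurable X]setTI; exact: (measurable_fst measurableT _ mB).
  - move=> s t l B C ts tt lB mC.
    have FT : F 0 setT.
      have [/(_ _ (times0 k)) [F0 FC _] _ _] := sm_filtration markovX.
      by rewrite -(setD0 setT); exact: FC.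
    have XE : X = (fun u => X (0 + u)) by apply/funext => u; rewrite add0r.
    by rewrite XE; exact: (shifted_markov markovX mu (times0 k)).
have sY B : measurable B -> sigma_of (times k) Y [set w | B (Y ^~ w : pathT k E)].
  apply: path_preimage => //; first exact: smallest_sigma_algebra.
    exact: rc_path_copy.
  by move=> t tt B0 mB0; exact: sigma_of_preimage.
(* One [g] must serve for all events, whereas conditional independence supplies a new pair of
   versions for each; it is taken from the certain event. *)
have [_ [g [_ [mg g01 gS] _]]] := indep _ (sY _ measurableT).
apply: (path_markov_reweight (g := EFin \o g) MM) => //.
- exact/measurable_EFinP.
- by move=> y; rewrite lee_fin; have /andP[] := g01 y.
move=> B mB; rewrite NE//.
have [f [gB [[mf f01 fB] [mgB gB01 gBS] [_ _ fgBS]]]] := indep _ (sY _ mB).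
have [lS lSE] := restricted_law (P' : {measure set Omega' -> \bar R}) mS m0.
have mYB : measurable [set w | B (Y ^~ w : pathT k E)].
  by rewrite -[X in measurable X]setTI; exact: mYp.
have [lB lBE] := restricted_law (P' : {measure set Omega' -> \bar R}) mYB m0.
have mE (h : borel E -> R) : measurable_fun setT h ->
    measurable_fun setT (fun y => (h y)%:E) by move=> mh; exact/measurable_EFinP.
have mEY (h : borel E -> R) : measurable_fun setT h ->
    measurable_fun setT (fun w => (h (Y 0 w))%:E).
  by move=> mh; apply/measurable_EFinP; exact: measurableT_comp.
have ge0 (h : borel E -> R) : (forall z, 0 <= h z <= 1) ->
    forall z, (0 <= (h z)%:E)%E.
  by move=> h01 z; rewrite lee_fin; have /andP[] := h01 z.
transitivity (\int[P']_w ((f (Y 0 w))%:E * (gB (Y 0 w))%:E))%E.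
  by have := fgBS _ measurableT; rewrite preimage_setT setIT; exact.
(* [gB] is exchanged for [g]: both are densities of the law of [Y 0] on [S], against which [f] is
   integrated. *)
transitivity (\int[lS]_y (f y)%:E)%E.
  symmetry.
  apply: (@ge0_integral_density _ _ _ _ _ P' (Y 0) (fun w => (gB (Y 0 w))%:E)) => //.
  - exact: mEY.
  - by move=> w; exact: ge0.
  - by move=> C mC; rewrite lSE setIC; exact: gBS.
  - exact: mE.
  - exact: ge0.
transitivity (\int[P']_w ((f (Y 0 w))%:E * (g (Y 0 w))%:E))%E.
  apply: (@ge0_integral_density _ _ _ _ _ P' (Y 0) (fun w => (g (Y 0 w))%:E)) => //.
  - exact: mEY.
  - by move=> w; exact: ge0.
  - by move=> C mC; rewrite lSE setIC; exact: gS.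
  - exact: mE.
  - exact: ge0.
under eq_integral do rewrite muleC.
(* Likewise [f] is exchanged for the indicator of [B], through the law of [Y 0] on the event that
   the path is in [B]. *)
transitivity (\int[lB]_y (g y)%:E)%E.
  symmetry.
  apply: (@ge0_integral_density _ _ _ _ _ P' (Y 0) (fun w => (f (Y 0 w))%:E)) => //.
  - exact: mEY.
  - by move=> w; exact: ge0.
  - by move=> C mC; rewrite lBE setIC; exact: fB.
  - exact: mE.
  - exact: ge0.
have mB1 : measurable_fun setT (fun x : pathT k E => (\1_B x)%:E : \bar R).
  exact/measurable_EFinP.
transitivity (\int[M]_x ((g (x 0))%:E * (\1_B x)%:E))%E; last first.
  by rewrite [RHS]integral_restrict.
have m0' := measurable_coord (E := E) (times0 k).
apply: (@ge0_integral_density _ _ _ _ _ M (fun x : pathT k E => x 0 : borel E)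
  (fun x => (\1_B x)%:E)) => //.
- move=> C mC; rewrite integral_indic//; last first.
    by rewrite -[X in measurable X]setTI; exact: m0'.
  by rewrite lBE ME setIT setIC.
- exact: mE.
- exact: ge0.
Qed.

End Copies.

(** * The parallel step *)

Section ExitEvents.
Context {R : realType} (k : time_kind) {E : pseudoPMetricType R}.

Lemma ereal_inf_time_valued (S : set R) : S `<=` times k ->
  ereal_inf (EFin @` S) = +oo%E \/
  exists2 t, times k t & ereal_inf (EFin @` S) = t%:E.
Proof.
move=> St; have S0 : (0 <= ereal_inf (EFin @` S))%E.
  by apply/ereal_infP => _ [t /St/times_ge0 t0 <-]; rewrite lee_fin.
case e : ereal_inf S0 => [r| |] // r0; last by left.
right; exists r => //; rewrite lee_fin in r0; case: k St => //= St.
have /andP[mr rm] := truncn_itv r0; set m := Num.truncn r in mr rm.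
have : (ereal_inf (EFin @` S) < m.+1%:R%:E)%E by rewrite e lte_fin.
move=> /ereal_inf_lt[_ [t tS <-]]; rewrite lte_fin => tm.
have rt : r <= t by rewrite -lee_fin -e; apply: ereal_inf_lbound; exists t.
have tE : t = m%:R.
  by apply: discrete_times_eq; [exact: St|rewrite (le_trans mr rt) natr1].
by exists m; apply/eqP; rewrite eq_le mr -tE rt.
Qed.

(** An exit within a time slice that starts at [s] and has length [u], with total time and position
    in [A]. The first two conditions make evaluation at the random time measurable. *)
Definition exit_event (A : set (\bar R * borel E)) (s u : R) :
    set (pathT k E * \bar R) :=
  [set z | [/\ rc_path k z.1, times k (fine z.2), (z.2 <= u%:E)%E &
               A (s%:E + z.2, z.1 (fine z.2))%E]].

Lemma measurable_exit_event A s u : measurable A ->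
  measurable (exit_event A s u).
Proof.
move=> mA; pose D : set (pathT k E * \bar R) :=
  [set z | rc_path k z.1 /\ times k (fine z.2)].
have mfine : measurable_fun setT (fun z : pathT k E * \bar R => fine z.2).
  by apply: measurableT_comp => //; exact: fine_measurable.
have mD : measurable D.
  have m1 := @measurable_fst _ _ (pathT k E) (\bar R) measurableT _ (@measurable_rc_path R k E).
  have m2 := mfine measurableT _ (measurable_times k).
  by have := measurableI _ _ m1 m2; rewrite !setTI.
pose ev (z : pathT k E * \bar R) : borel E := z.1 (fine z.2).
have mev : measurable_fun D ev.
  apply: (@measurable_fun_eval _ k E _ (pathT k E * \bar R)%type D
    (fun t z => z.1 t) (fun z => fine z.2)) => //.
  - by move=> z [].
  - move=> t tt; apply: measurable_funTS.
    exact: measurableT_comp (measurable_coord tt) measurable_fst.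
  - exact: measurable_funTS.
  - by move=> z [].
have mpair : measurable_fun setT
    (fun z : pathT k E * \bar R => (s%:E + z.2, (ev \_ D) z)%E).
  apply: measurable_fun_pair; first exact: emeasurable_funD.
  exact/(measurable_restrictT _ mD).
have mle : measurable [set z : pathT k E * \bar R | (z.2 <= u%:E)%E].
  by rewrite -[X in measurable X]setTI; exact: emeasurable_fun_infty_c.
have := measurableI _ _ (measurableI _ _ mD mle) (mpair measurableT _ mA).
rewrite setTI; congr measurable; apply/seteqP; split => z /=.
  by move=> [[[rz tz] le]]; rewrite patchE mem_set//; split.
by move=> [rz tz le Az]; rewrite patchE mem_set//; split => //; split.
Qed.

Lemma exit_time_pos_eq d (Omega : measurableType d) (U : set E)
    (X : R -> Omega -> borel E) w : U (X 0 w) ->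
  exit_time_pos k U X w = exit_time k U X w.
Proof.
move=> U0; congr ereal_inf; apply/seteqP; split => s [t].
  by move=> [tt _ Ut] <-; exists t.
move=> [tt Ut] <-; exists t => //; split => //; rewrite lt_def (times_ge0 tt) andbT.
by apply/eqP => t0; apply: Ut; rewrite t0.
Qed.

End ExitEvents.

Section ParallelIndex.
Context {R : realType} d (Omega : measurableType d)
  (T : nat -> Omega -> \bar R) (t : nat -> R).

(** Copies are numbered from 1, so this concerns the first [n]; the form is that of the conditioning
    event for copy n + 1. *)
Definition all_survive n : set Omega :=
  [set w | forall j, (1 <= j < n.+1)%N -> ((t j)%:E < T j w)%E].

Lemma all_surviveS n :
  all_survive n.+1 = all_survive n `&` [set w | ((t n.+1)%:E < T n.+1 w)%E].
Proof.
apply/seteqP; split => w /=.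
  by move=> h; split => [j /andP[j1 jn]|]; apply: h; rewrite ?ltnSn// j1 ltnS ltnW.
move=> [h hn] j /andP[j1]; rewrite ltnS leq_eqVlt => /predU1P[->//|jn].
by apply: h; rewrite j1.
Qed.

Lemma par_index_Some n w : all_survive n w -> (T n.+1 w <= (t n.+1)%:E)%E ->
  par_index T t w = Some n.+1.
Proof.
move=> Sn Tn; rewrite /par_index; case: pselect => [h|]; last first.
  by case; exists n.+1.
case: ex_minnP => m mP mmin; have /andP[m1 Tm] := mP; congr Some; apply/eqP.
rewrite eqn_leq mmin ?Tn//= leqNgt; apply/negP => mn.
by have := Sn m; rewrite m1 mn => /(_ isT); rewrite ltNge Tm.
Qed.

Lemma par_index_None w : (forall n, all_survive n w) -> par_index T t w = None.
Proof.
move=> S; rewrite /par_index; case: pselect => // h; exfalso.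
case: h => m /andP[m1 Tm].
by have := S m m; rewrite m1 ltnSn => /(_ isT); rewrite ltNge Tm.
Qed.

Lemma par_index_cases w : (forall n, all_survive n w) \/
  exists2 n, all_survive n w & (T n.+1 w <= (t n.+1)%:E)%E.
Proof.
have [[m /andP[m1 Tm]]|h] :=
    pselect (exists m, (1 <= m)%N && (T m w <= (t m)%:E)%E); last first.
  left=> n j /andP[j1 _]; rewrite ltNge; apply/negP => Tj.
  by apply: h; exists j; rewrite j1.
right; have ex : exists m, (1 <= m)%N && (T m w <= (t m)%:E)%E by exists m; rewrite m1.
case: (ex_minnP ex) => -[|n] //= Tn nmin; exists n => // j /andP[j1 jn].
rewrite ltNge; apply/negP => Tj.
by have := nmin j; rewrite j1 Tj => /(_ isT); rewrite leqNgt jn.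
Qed.

End ParallelIndex.

Section CopySurvival.
Context {R : realType} (k : time_kind) {E : pseudoPMetricType R}.
Context d (Omega : measurableType d)
  (F : R -> set (set Omega)) (X : R -> Omega -> borel E)
  (P : probability (borel E) R -> probability Omega R)
  (p : R -> R.-pker (borel E) ~> (borel E)) (U : set E).
Hypotheses (markovX : strong_markov k F X P p) (oU : open U).
Context d' (Omega' : measurableType d') (P' : probability Omega' R).

(** Conditional independence concerns the paths of the copies, survival their times; the time is
    recovered from the path up to a null set. *)
Lemma copy_survival (Y : R -> Omega' -> borel E) (T : Omega' -> \bar R) r :
  is_copy k X P U P' Y T -> exists A N : set Omega',
  [/\ sigma_of (times k) Y A, measurable N, P' N = 0%E &
      forall w, ~ N w -> A w <-> (r%:E < T w)%E].
Proof.
move=> copyY; have rY := rc_path_copy copyY; have mY := measurable_copy copyY.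
have mS := measurable_copy_time copyY; have mYp := measurable_path rY mY.
have [N NE] := restricted_law (P' : {measure set Omega' -> \bar R}) measurableT
  (measurable_fun_pair mYp mS).
have [||f mf Nf] := exit_functional oU (N := N).
- by rewrite NE setIT preimage_setT; apply: le_lt_trans (ltry 1); exact: probability_le1.
- by move=> B mB hB; rewrite NE; exact: (copy_concentrated markovX copyY measurableT).
exists [set w | (r%:E < f (Y ^~ w))%E].
exists [set w | f (Y ^~ w) != T w]; split.
- apply: (path_preimage (smallest_sigma_algebra _ _) rY _ (B := [set x | (r%:E < f x)%E])).
    by move=> t tt B mB; exact: sigma_of_preimage.
  by rewrite -[X in measurable X]setTI; exact: emeasurable_fun_o_infty.
- rewrite -[X in measurable X]setTI; apply: measurable_neqe => //.
  exact: measurableT_comp mf mYp.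
- by have := Nf; rewrite NE setIT.
- by move=> w /negP; rewrite negbK => /eqP /= ->.
Qed.

Variables (Xm : nat -> R -> Omega' -> borel E) (Tm : nat -> Omega' -> \bar R)
  (tm : nat -> R).
Hypothesis copies : forall m, (1 <= m)%N -> is_copy k X P U P' (Xm m) (Tm m).

Let past m := sigma_of [set js : nat * R | (1 <= js.1 < m)%N /\ times k js.2]
  (fun js => Xm js.1 js.2).

Lemma all_survive_past n : exists A N : set Omega',
  [/\ past n.+1 A, measurable N, P' N = 0%E &
      forall w, ~ N w -> A w <-> all_survive Tm tm n w].
Proof.
elim: n => [|n [A [N [sA mN N0 AS]]]].
  exists setT, set0; split => //.
    by rewrite -(setD0 setT); apply: sigma_algebraCD; exact: sigma_algebra0.
  by move=> w _; split => // _ [|j] //; rewrite ltnS.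
have [A' [N' [sA' mN' N'0 AS']]] := copy_survival (tm n.+1) (copies (ltn0Sn n)).
have sub : past n.+1 `<=` past n.+2.
  apply: smallest_sub; first exact: smallest_sigma_algebra.
  move=> _ [[j s] [/andP[j1 jn] ts] [B mB <-]]; apply: sub_sigma_algebra.
  by exists (j, s); [split => //=; rewrite j1 ltnS ltnW|exists B].
have sub' : sigma_of (times k) (Xm n.+1) `<=` past n.+2.
  apply: smallest_sub; first exact: smallest_sigma_algebra.
  move=> _ [s ts [B mB <-]]; apply: sub_sigma_algebra.
  by exists (n.+1, s); [split => //=; rewrite ltnSn|exists B].
exists (A `&` A'), (N `|` N'); split.
- have [|_ _ _] := (sigma_algebraP (U := setT) (C := past n.+2) _).1
    (smallest_sigma_algebra _ _); first by [].
  by apply; [exact: sub|exact: sub'].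
- exact: measurableU.
- apply/negligibleP; first exact: measurableU.
  by apply: negligibleU; apply/negligibleP.
- move=> w /not_orP[Nw N'w]; rewrite all_surviveS.
  have [h1 h2] := AS w Nw; have [h1' h2'] := AS' w N'w.
  by split => -[u v]; split; [exact: h1|exact: h1'|exact: h2|exact: h2'].
Qed.

End CopySurvival.

(** Valid for null [B] too, where both sides vanish. *)
Lemma cprob_mul d (T : measurableType d) (R : realType) (P : probability T R)
    (A B : set T) : measurable A -> measurable B ->
  P (A `&` B) = (P B * (cprob P A B)%:E)%E.
Proof.
move=> mA mB; have mAB : measurable (A `&` B) by exact: measurableI.
have PAB := fin_num_measure P _ mAB; have PB := fin_num_measure P _ mB.
have [B0|B0] := eqVneq (P B) 0%E.
  by rewrite B0 mul0e; apply: (@subset_measure0 _ _ _ P _ B).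
rewrite /cprob -{1}(fineK PB) -EFinM mulrC divfK ?fineK//.
by apply: contra B0 => /eqP fB; rewrite -(fineK PB) fB.
Qed.

Theorem theorem5p2 (R : realType) (k : time_kind)
  (E : pseudoPMetricType R)
  (metrizableE : hausdorff_space E)
  (standardE : standard_borel R (borel E))
  (d : measure_display) (Omega : measurableType d)
  (F : R -> set (set Omega)) (X : R -> Omega -> borel E)
  (P : probability (borel E) R -> probability Omega R)
  (p : R -> R.-pker (borel E) ~> (borel E))
  (markovX : strong_markov k F X P p)
  (U : set E) (openU : open U)
  (rho : probability (borel E) R) (qsd_rho : qsd_assumption k X P U rho)
  (measurable_T : measurable_fun setT (exit_time k U X))
  (measurable_Tpos : measurable_fun setT (exit_time_pos k U X))
  (finite_T : P rho [set w | (exit_time k U X w < +oo)%E] = 1%E)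
  (d' : measure_display) (Omega' : measurableType d')
  (P' : probability Omega' R)
  (Xm : nat -> R -> Omega' -> borel E) (Tm : nat -> Omega' -> \bar R)
  (tm : nat -> R)
  (copies : forall m, (1 <= m)%N -> is_copy k X P U P' (Xm m) (Tm m))
  (tm_time : forall m, (1 <= m)%N -> times k (tm m) /\ 0 < tm m)
  (tm_diverges : (\sum_(1 <= m <oo) (tm m)%:E = +oo)%E)
  (cond_indep : forall m, (1 <= m)%N ->
     cond_independent P' (Xm m 0)
       (sigma_of (times k) (Xm m))
       (sigma_of [set js : nat * R | (1 <= js.1 < m)%N /\ times k js.2]
                 (fun js => Xm js.1 js.2)))
  (law_first : forall A : set (borel E), measurable A ->
     P' (Xm 1%N 0 @^-1` A) = rho A)
  (law_next : forall m, (2 <= m)%N ->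
     forall A : set (borel E), measurable A ->
     (cprob P' (Xm m 0 @^-1` A)
        [set w | forall j, (1 <= j < m)%N -> ((tm j)%:E < Tm j w)%E])%:E
     = rho A) :
  forall A : set (\bar R * borel E), measurable A ->
    P' [set w | A (par_time Tm tm w, par_exit Xm Tm tm w)] =
    P rho [set w | A (exit_time_pos k U X w,
                      X (fine (exit_time_pos k U X w)) w)].
Proof.
have rX := @rc_path_markov _ _ _ _ _ _ _ _ _ markovX.
have mX := @measurable_process _ _ _ _ _ _ _ _ _ markovX.
have [[rhoU qsdE] _ _] := qsd_rho.
pose e := exit_time k U X.
have mU : measurable (U : set (borel E)) := measurable_open openU.
have mgt r : measurable [set w | (r%:E < e w)%E].
  by rewrite -[X in measurable X]setTI; exact: emeasurable_fun_o_infty.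
have rhoUC : rho (~` U) = 0%E by rewrite probability_setC// rhoU subee.
(* The quasistationarity equation is given for subsets of [U]; since [rho] lives on [U] and
   surviving paths are in [U], it extends to every [B]. *)
have survE r (B : set (borel E)) : times k r -> measurable B ->
    P rho (X r @^-1` B `&` [set w | (r%:E < e w)%E]) =
    (P rho [set w | (r%:E < e w)%E] * rho B)%E.
  move=> tr mB; have mBU : measurable (B `&` U) by exact: measurableI.
  have -> : rho B = rho (B `&` U).
    apply: (measure_eq_off_null mB mBU (measurableC mU) rhoUC).
    by move=> y /contrapT Uy; split => [|[]].
  rewrite (qsdE r tr _ mBU); last exact: subIsetr.
  rewrite -cprob_mul//; last first.
    by rewrite -[X in measurable X]setTI; exact: mX.
  congr (P rho _); apply/seteqP; split => w [] /=; last by move=> [].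
  move=> Bw ew; split => //; split => //.
  exact: (path_exit_gt tr (lexx r) ew).
(* Copy n + 1 covers the slice of total time from [s n] to [s n.+1]. *)
pose s n := \sum_(1 <= m < n.+1) tm m.
have s0 : s 0%N = 0 by rewrite /s big_geq.
have sS n : s n.+1 = s n + tm n.+1 by rewrite /s big_nat_recr.
have tmt n : times k (tm n.+1) by have [] := tm_time n.+1 isT.
have ts n : times k (s n).
  elim: n => [|n ih]; first by rewrite s0; exact: times0.
  by rewrite sS; exact: timesD.
pose G := all_survive Tm tm.
have copy n : is_copy k X P U P' (Xm n.+1) (Tm n.+1) by exact: copies.
have mTm n : measurable_fun setT (Tm n.+1) := measurable_copy_time (copy n).
have mXm n t : times k t -> measurable_fun setT (Xm n.+1 t) := measurable_copy (copy n) (t := t).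
have mG n : measurable (G n).
  elim: n => [|n ih].
    by rewrite (_ : G 0%N = setT)//; apply/seteqP; split => // w _ [|j].
  rewrite /G all_surviveS; apply: measurableI => //.
  by rewrite -[X in measurable X]setTI; exact: emeasurable_fun_o_infty.
have G0 n (B : set (borel E)) : measurable B ->
    P' (Xm n.+1 0 @^-1` B `&` G n) = (P' (G n) * rho B)%E.
  move=> mB; case: n => [|n].
    rewrite (_ : G 0%N = setT) ?setIT ?probability_setT ?mul1e ?law_first//.
    by apply/seteqP; split => // w _ [|j].
  rewrite -(law_next n.+2)// -cprob_mul//.
  by rewrite -[X in measurable X]setTI; apply: mXm => //; exact: times0.
have mpair n : measurable_fun setT (fun w => (Xm n.+1 ^~ w : pathT k E, Tm n.+1 w)).
  apply: measurable_fun_pair => //.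
  exact: (measurable_path (rc_path_copy (copy n)) (mXm n)).
have K1 n (B : set (pathT k E * \bar R)) : measurable B ->
    P' ([set w | B (Xm n.+1 ^~ w, Tm n.+1 w)] `&` G n) =
    (P' (G n) * P rho [set w | B (X ^~ w, e w)])%E.
  move=> mB.
  have [A [N [sA mN N0 AG]]] := all_survive_past markovX openU tm copies n.
  have mA : measurable A.
    apply: sigma_of_sub sA => -[[|j] t] [] //= _ tt; exact: mXm.
  have P'A (B' : set Omega') : measurable B' -> P' (B' `&` G n) = P' (B' `&` A).
    move=> mB'; apply: (measure_eq_off_null _ _ mN N0); [exact: measurableI..|].
    by move=> w /AG[h1 h2]; split => -[b h]; split => //; [exact: h2|exact: h1].
  have mBX : measurable [set w | B (Xm n.+1 ^~ w, Tm n.+1 w)].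
    by rewrite -[X in measurable X]setTI; exact: mpair.
  rewrite P'A// -[G n]setTI P'A// setTI.
  apply: (regenerates_law markovX openU measurable_T (Q := P')) => //.
  - by apply: le_lt_trans (ltry 1); exact: probability_le1.
  - exact: (rc_path_copy (copy n)).
  - exact: mXm.
  - apply: (copy_regenerates markovX (copy n)) => // C sC.
    exact: (cond_indep n.+1).
  - move=> C mC.
    have mC0 : measurable (Xm n.+1 0 @^-1` C).
      by rewrite -[X in measurable X]setTI; apply: mXm => //; exact: times0.
    by have := G0 n C mC; rewrite P'A// -[G n]setTI P'A// setTI.
  - exact: (copy_concentrated markovX (copy n)).
have K2 n (B : set (pathT k E * \bar R)) : measurable B ->
    P rho ([set w | B (fun u => X (s n + u) w, (e w - (s n)%:E)%E)]
           `&` [set w | ((s n)%:E < e w)%E]) =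
    (P rho [set w | ((s n)%:E < e w)%E] * P rho [set w | B (X ^~ w, e w)])%E.
  by move=> mB; apply: (restart markovX) => // C mC; exact: survE.
have Ue0 w : U (X 0 w) -> (0 < e w)%E.
  move=> U0; apply: (path_exit_gtP openU (rX w)) => u tu u0.
  by rewrite (_ : u = 0)//; apply/le_anti; rewrite u0 (times_ge0 tu).
(* By [K1] and [K2] each step multiplies both sides by the same factor, the probability under
   [P rho] that the exit time exceeds [tm n.+1]. Both start from 1, because [rho] charges only
   [U]. *)
have K3 n : P' (G n) = P rho [set w | ((s n)%:E < e w)%E].
  elim: n => [|n ih].
    have -> : G 0%N = setT by apply/seteqP; split => // w _ [|j].
    rewrite probability_setT s0; apply/eqP; rewrite eq_le probability_le1// andbT.
    rewrite -[leLHS]rhoU -(sm_initial markovX rho mU).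
    apply: le_measure; rewrite ?inE; [|exact: mgt|by move=> w; exact: Ue0].
    by rewrite -[X in measurable X]setTI; exact: (mX _ (times0 k) measurableT _ mU).
  have mB : measurable [set z : pathT k E * \bar R | ((tm n.+1)%:E < z.2)%E].
    by rewrite -[X in measurable X]setTI; exact: emeasurable_fun_o_infty.
  rewrite /G all_surviveS setIC [LHS](K1 n _ mB) -/G ih -[LHS](K2 n _ mB).
  congr (P rho _); apply/seteqP; split => w /=; rewrite EFinN lteBrDl// -EFinD -sS.
    by move=> [].
  move=> h; split => //; apply: le_lt_trans h; rewrite lee_fin sS lerDl.
  exact: times_ge0 (tmt n).
(* [En] is the exit of copy n + 1 in its slice after all earlier copies survived, [En'] the exit of
   the single process in the same slice. *)
pose En A n := [set w | exit_event A (s n) (tm n.+1) (Xm n.+1 ^~ w : pathT k E, Tm n.+1 w)] `&` G n.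
pose En' A n := [set w | exit_event A (s n) (tm n.+1)
    ((fun u => X (s n + u) w) : pathT k E, (e w - (s n)%:E)%E)] `&`
  [set w | ((s n)%:E < e w)%E].
have mEn A n : measurable A -> measurable (En A n).
  move=> mA; apply: measurableI => //; rewrite -[X in measurable X]setTI.
  exact: mpair (measurable_exit_event (s n) (tm n.+1) mA).
have mEn' A n : measurable A -> measurable (En' A n).
  move=> mA; apply: measurableI => //; rewrite -[X in measurable X]setTI.
  have mB := measurable_exit_event (k := k) (s n) (tm n.+1) mA.
  apply: (measurable_fun_pair _ _ measurableT mB); last first.
    exact: emeasurable_funB.
  apply: (measurable_path (Y := fun u w => X (s n + u) w)).
    by move=> w; exact: (rc_path_shift (ts n) (rX w)).
  by move=> u tu; apply: mX; exact: timesD.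
have EnP A n w : En A n w <-> [/\ G n w, (Tm n.+1 w <= (tm n.+1)%:E)%E &
    A (par_time Tm tm w, par_exit Xm Tm tm w)].
  split => [[[rz tz Tt Aw] Gn]|[Gn Tt Aw]].
    by split => //; rewrite /par_time /par_exit (par_index_Some Gn Tt).
  split => //; split => //=.
  - exact: (rc_path_copy (copy n)).
  - have [_ _ tv _ _] := copy n.
    by have [->|[t tt ->]] := tv w => //=; exact: times0.
  - by move: Aw; rewrite /par_time /par_exit (par_index_Some Gn Tt).
have snd_s i j : (i <= j)%N -> s i <= s j.
  elim: j => [|j ih]; first by rewrite leqn0 => /eqP ->.
  rewrite leq_eqVlt => /predU1P[->//|/ih h]; apply: (le_trans h).
  by rewrite sS lerDl; exact: times_ge0 (tmt j).
have En'P A n w : En' A n w <-> [/\ ((s n)%:E < e w)%E, (e w <= (s n.+1)%:E)%E &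
    A (e w, X (fine (e w)) w)].
  have [eoo|[r [tr er _]]] := path_exit_attained openU (rX w).
    have {}eoo : e w = +oo%E by [].
    by split => [[[_ _ + _] _]|[_ + _]] //=; rewrite eoo //=.
  have {}er : e w = r%:E by [].
  have rE : s n + (r - s n) = r by rewrite addrC subrK.
  split => [[[_ _ le Aw] /= sr]|[sr le Aw]].
    move: le Aw sr; rewrite /= er -EFinB -EFinD /= rE => le Aw sr; split => //.
    by move: le; rewrite !lee_fin sS lerBlDl.
  move: sr le Aw; rewrite er /= => sr le Aw; split; last by rewrite /= er.
  split; rewrite /= ?er.
  - exact: (rc_path_shift (ts n) (rX w)).
  - by apply: timesB => //; rewrite -lee_fin ltW.
  - by move: le; rewrite -EFinB !lee_fin sS lerBlDl.
  - by rewrite -EFinB -EFinD /= rE.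
have tEn A : trivIset setT (En A).
  apply/trivIsetP => i j _ _ ij; apply/seteqP; split => // w [/EnP[Gi Ti _] /EnP[Gj Tj _]].
  have := par_index_Some Gi Ti; rewrite (par_index_Some Gj Tj) => -[ji].
  by rewrite ji eqxx in ij.
have tEn' A : trivIset setT (En' A).
  apply/trivIsetP => i j _ _ ij; apply/seteqP; split => // w [/En'P[si ei _] /En'P[sj ej _]].
  have lt_ij a b : (a < b)%N -> (e w <= (s a.+1)%:E)%E -> ((s b)%:E < e w)%E -> False.
    move=> ab ea eb; have := lt_le_trans eb ea; rewrite lte_fin ltNge.
    by rewrite snd_s.
  case: (ltngtP i j) ij => // ij _; first exact: lt_ij ij ei sj.
  exact: lt_ij ij ej si.
have EE A : measurable A -> P' (\bigcup_n En A n) = P rho (\bigcup_n En' A n).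
  move=> mA; rewrite (measure_semi_bigcup P' (fun n => mEn A n mA) (tEn A)); last first.
    by apply: bigcup_measurable => n _; exact: mEn.
  rewrite (measure_semi_bigcup (P rho) (fun n => mEn' A n mA) (tEn' A)); last first.
    by apply: bigcup_measurable => n _; exact: mEn'.
  apply: eq_eseriesr => n _.
  have mB := measurable_exit_event (k := k) (s n) (tm n.+1) mA.
  by rewrite [LHS](K1 n _ mB) K3 -[LHS](K2 n _ mB).
have sdiv (r : R) : exists n, r <= s n.
  apply: contrapT => /forallNP sr.
  have : (\sum_(1 <= m <oo) (tm m)%:E <= r%:E)%E.
    apply: lime_le.
      apply: is_cvg_nneseries => m m1 _; rewrite lee_fin.
      by apply: times_ge0; exact: (tm_time m m1).1.
    apply: nearW => -[|n]; rewrite sumEFin lee_fin; last first.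
      by rewrite leNgt; apply/negP => /ltW; exact: sr.
    rewrite big_geq//; have := sr 0%N; rewrite s0 => /negP.
    by rewrite -ltNge => /ltW /le_trans; apply.
  by rewrite tm_diverges leye_eq.
have En'U A w : U (X 0 w) -> (e w < +oo)%E ->
    (\bigcup_n En' A n) w <-> A (e w, X (fine (e w)) w).
  move=> U0 efin; split=> [[n _ /En'P[]]//|Aw].
  have [r er] : exists r, e w = r%:E.
    exists (fine (e w)); rewrite fineK// ge0_fin_numE//; exact/ltW/Ue0.
  (* The slice is the one before the first [s m] that reaches the exit time; m = 0 is excluded as
     the exit time from a point of [U] is positive. *)
  have [m rm] := sdiv r; have exm : exists m, r <= s m by exists m.
  case: (ex_minnP exm) => -[|n] rn nmin.
    by have := Ue0 w U0; rewrite er lte_fin ltNge -s0 rn.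
  exists n => //; apply/En'P; split => //; rewrite er ?lee_fin// lte_fin ltNge.
  by apply/negP => /nmin; rewrite ltnn.
have mU0 : measurable (X 0 @^-1` U).
  by rewrite -[X in measurable X]setTI; exact: (mX _ (times0 k) measurableT _ mU).
have mfin : measurable [set w | (e w < +oo)%E].
  by rewrite -[X in measurable X]setTI; exact: emeasurable_fun_infty_o.
(* Off this null set the two exit times agree and the exit falls in some slice. *)
pose N := ~` (X 0 @^-1` U) `|` ~` [set w | (e w < +oo)%E].
have mN : measurable N by apply: measurableU; exact: measurableC.
have N0 : P rho N = 0%E.
  apply/negligibleP => //; apply: negligibleU; apply/negligibleP.
  - exact: measurableC.
  - by rewrite [LHS]probability_setC// (sm_initial markovX rho mU) rhoU subee.
  - exact: measurableC.
  - by rewrite [LHS]probability_setC// finite_T subee.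
have NP w : ~ N w -> U (X 0 w) /\ (e w < +oo)%E.
  by move=> /not_orP[/contrapT ? /contrapT].
move=> A mA.
have mUEn' B : measurable B -> measurable (\bigcup_n En' B n).
  by move=> mB; apply: bigcup_measurable => n _; exact: mEn'.
have mUEn B : measurable B -> measurable (\bigcup_n En B n).
  by move=> mB; apply: bigcup_measurable => n _; exact: mEn.
have mpos : measurable_fun setT (fun w => X (fine (exit_time_pos k U X w)) w).
  apply: (measurable_fun_eval (k := k) (Y := X)) => //.
  - exact: measurableT_comp (fine_measurable measurableT) measurable_Tpos.
  - move=> w _; have [|h|[t tt h]] := @ereal_inf_time_valued R k
      [set t | [/\ times k t, 0 < t & ~ U (X t w)]].
    + by move=> t [].
    + by rewrite [exit_time_pos _ _ _ _]h; exact: times0.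
    + by rewrite [exit_time_pos _ _ _ _]h.
have -> : P rho [set w | A (exit_time_pos k U X w, X (fine (exit_time_pos k U X w)) w)] =
    P rho (\bigcup_n En' A n).
  apply: (measure_eq_off_null _ _ mN N0); last 1 first.
  - move=> w /NP[U0 efin]; rewrite /= exit_time_pos_eq//.
    by have [h1 h2] := En'U A w U0 efin; split.
  - rewrite -[X in measurable X]setTI.
    exact: (measurable_fun_pair measurable_Tpos mpos measurableT mA).
  - exact: mUEn'.
rewrite -EE//.
(* That some copy almost surely exits in its slice follows from [EE] for the full set, since the
   single process does so with probability 1. *)
pose H := \bigcup_n En setT n.
have mH : measurable H by exact: mUEn.
have H0 : P' (~` H) = 0%E.
  rewrite probability_setC// EE// (_ : P rho _ = 1%E) ?subee//.
  rewrite -(probability_setT (P rho)); apply: (measure_eq_off_null _ _ mN N0) => //.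
    exact: mUEn'.
  by move=> w /NP[U0 efin]; split => // _; apply/En'U.
(* Off [H] the index is [None] and the pair takes its constant default value, which also makes the
   event on the left-hand side measurable. *)
have HN w : ~ H w -> (par_time Tm tm w, par_exit Xm Tm tm w) = (+oo%E, point).
  move=> Hw; have [Gall|[n Gn Tn]] := par_index_cases Tm tm w; last first.
    by exfalso; apply: Hw; exists n => //; apply/EnP.
  by rewrite /par_time /par_exit par_index_None.
have HA w : H w ->
    (\bigcup_n En A n) w <-> A (par_time Tm tm w, par_exit Xm Tm tm w).
  move=> [n _ /EnP[Gn Tn _]]; split => [[m _ /EnP[]]//|Aw].
  by exists n => //; apply/EnP.
apply: (measure_eq_off_null _ _ (measurableC mH) H0); last 1 first.
- by move=> w /contrapT /HA[h1 h2]; split.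
- have -> : [set w | A (par_time Tm tm w, par_exit Xm Tm tm w)] =
      \bigcup_n En A n `|` ~` H `&` [set _ | A (+oo%E, point)].
    apply/seteqP; split => w /=.
      have [Hw|Hw] := pselect (H w); first by move=> Aw; left; exact/(HA w Hw).
      by rewrite (HN w Hw); right.
    by move=> [[n _ /EnP[]]//|[Hw Aw]]; rewrite HN.
  apply: measurableU; first exact: mUEn.
  apply: measurableI; first exact: measurableC.
  have [Aoo|nAoo] := pselect (A (+oo%E, point)).
    by rewrite (_ : [set _ | _] = setT)//; apply/seteqP; split.
  by rewrite (_ : [set _ | _] = set0)//; apply/seteqP; split.
- exact: mUEn.
Qed.
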